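(* Let $0<r<R$, $p,d\in\mathbb{N}$ (positive integers), and let $(w_n)_n$, $(v_n)_n$ be countable families, indexed by natural numbers $n$, of weight functions $w_n\in\mathcal{H}_R^{d,p}$ and analytic maps $v_n:\mathcal{E}_R^{d,p}\to\mathcal{E}_r^{d,p}$ with $\sum_n\|w_n\|_{\mathcal{H}_R^{d,p}}\le W<\infty$. Let $\mathcal{L}:\mathcal{H}_r^{d,p}\to\mathcal{H}_R^{d,p}$, $\mathcal{L}\varphi=\sum_n w_n\cdot(\varphi\circ v_n)$. Assume additionally that for some $\alpha\in\mathbb{R}$, some $\nu>0$ and every fixed $x\in[-1,1]^d$, $n^\alpha w_n(x)$ and $v_n(x)$ extend to analytic families for $n\in\hat{\mathbb{C}}\setminus B(0,\nu)$. Then for any $\varphi\in\mathcal{H}_r^{d,p}$ the function $\mathcal{L}\varphi$ can be evaluated at any point of $[-1,1]^d$ with arbitrary precision by evaluating a finite sum. Namely, for any $\mathrm{Err}>0$ there exist a sequence of complex numbers $\{n_q\}$ and a sequence of complex-valued weights $\{w_q(\cdot)\}$ on $[-1,1]^d$, both of length $Q=O(\log\mathrm{Err}^{-1})$ (as $\mathrm{Err}\to0$), depending on the system $(w_n,v_n)_n$ (and on $\mathrm{Err}$) only and not on $\varphi$, such that for all $\varphi\in\mathcal{H}_r^{d,p}$ and all $x\in[-1,1]^d$ $$\left|[\mathcal{L}\varphi](x)-\sum_{q=1}^Q w_q(x)\,\varphi(v_{n_q}(x))\right|\le\|\varphi\|_{\mathcal{H}_r^{d,p}}\cdot\mathrm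{Err}.$$
   Context: For $d\ge1$, $p\in[1,\infty]$, $r>0$ let $\mathrm{Ball}_r^{d,p}=\{x\in\mathbb{R}^d:\|x\|_p<r\}$ and $\mathcal{E}_r^{d,p}=\cos(\mathbb{R}^d+i\,\mathrm{Ball}_r^{d,p})\subset\mathbb{C}^d$, with $\cos$ applied componentwise. $\mathcal{H}_r^{d,p}$ is the Banach space of functions $\varphi$ that are holomorphic on $\mathcal{E}_r^{d,p}$, continuous on its closure, and satisfy $\varphi([-1,1]^d)\subseteq\mathbb{R}$, with norm $\|\varphi\|_{\mathcal{H}_r^{d,p}}=\sup_{z\in\mathcal{E}_r^{d,p}}|\varphi(z)|$. It is a standing assumption that $\mathcal{L}\varphi\in\mathcal{H}_R^{d,p}$ for every $\varphi\in\mathcal{H}_r^{d,p}$. $\hat{\mathbb{C}}$ is the Riemann sphere and $B(0,\nu)$ is the disc of radius $\nu$ centred at $0$ in the complex $n$-plane; for complex $n$, $v_n(x)$ denotes the analytic extension in $n$.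
   Formalization: The analytic extension v_n(x) is additionally assumed to take values in E_r^{d,p} for all x in [-1,1]^d and all n in the Riemann sphere outside B(0,ν), including n=∞; without this the claimed Q=O(log Err^{-1}) can fail (e.g. d=1, w_n=n^{-2}, v_n=cosh r − c/n). *)

(* Defs.v *)
From HB Require Import structures.
From mathcomp Require Export all_boot all_order all_algebra.
From mathcomp Require Export complex.
From mathcomp Require Export all_classical all_reals all_analysis.

Export Order.TTheory GRing.Theory Num.Theory.
Export numFieldNormedType.Exports.

Set Implicit Arguments.
Unset Strict Implicit.
Unset Printing Implicit Defensive.

Local Open Scope classical_set_scope.
Local Open Scope ring_scope.
Local Open Scope complex_scope.

(* R[i] as a normed space over itself, with the topology of the modulus. *)
HB.instance Definition _ (R : realType) := GRing.ComAlgebra.copy R[i] R[i]^o.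
HB.instance Definition _ (R : realType) := Vector.copy R[i] R[i]^o.
HB.instance Definition _ (R : realType) := NormedModule.copy R[i] R[i]^o.

Section Domains.
Context {R : realType}.

Definition cexp (z : R[i]) : R[i] :=
  (expR (complex.Re z) * cos (complex.Im z)) +i*
  (expR (complex.Re z) * sin (complex.Im z)).

Definition ccos (z : R[i]) : R[i] := (cexp ((0 +i* 1) * z) + cexp (- ((0 +i* 1) * z))) / 2.

Definition pnorm (p d : nat) (x : 'rV[R]_d) : R :=
  (\sum_(j < d) `|x 0 j| ^+ p) `^ p%:R^-1.

Definition pball (p d : nat) (r : R) : set 'rV[R]_d :=
  [set y | pnorm p y < r].

Definition Edom (p d : nat) (r : R) : set 'rV[R[i]]_d :=
  [set z | exists x y : 'rV[R]_d,
     pball p r y /\ z = \row_j ccos (x 0 j +i* y 0 j)].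

Definition cube (d : nat) : set 'rV[R[i]]_d :=
  [set z | exists2 x : 'rV[R]_d,
     (forall j, -1 <= x 0 j <= 1) & z = \row_j (x 0 j)%:C].

End Domains.

Section Spaces.
Context {R : realType}.

(* Differentiability is over the field R[i], that is, complex Frechet
   differentiability; [D] is meant to be open. *)
Definition holomorphic_on (V W : normedModType R[i]) (D : set V) (f : V -> W) :=
  forall z, D z -> differentiable f z.

(* Functions are total; values outside the closure of [Edom p r] are junk. *)
Definition Hspace (p d : nat) (r : R) : set ('rV[R[i]]_d -> R[i]) :=
  [set phi : 'rV[R[i]]_d -> R[i] |
    [/\ holomorphic_on (Edom p r) phi,
        {within closure (Edom p r), continuous phi} &
        forall x, cube x -> phi x \is Num.real]].

Definition Hnorm (p d : nat) (r : R) (phi : 'rV[R[i]]_d -> R[i]) : R :=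
  sup [set complex.Re `|phi z| | z in Edom p r].

Definition transfer (d : nat) (w : nat -> 'rV[R[i]]_d -> R[i])
    (v : nat -> 'rV[R[i]]_d -> 'rV[R[i]]_d)
    (phi : 'rV[R[i]]_d -> R[i]) (x : 'rV[R[i]]_d) : R[i] :=
  limn (series (fun n => w n x * phi (v n x))).

End Spaces.

Section RiemannSphere.
Context {R : realType}.

(* [Some n] is the finite point n and [None] is the point at infinity. *)
Definition sphere : Type := one_point_compactification R[i].

Definition sphere_inv (z : R[i]) : sphere :=
  if z == 0 then None else Some z^-1.

Definition outside_disc (nu : R) : set sphere :=
  [set s | if s is Some n then nu%:C <= `|n| else true].

(* Analyticity in a neighbourhood of a point of the sphere, in the charts n
   and 1/n. *)
Definition sphere_analytic_at (V : normedModType R[i]) (f : sphere -> V)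
    (s : sphere) : Prop :=
  if s is Some n then
    \forall m \near n, differentiable (fun m' : R[i] => f (Some m')) m
  else \forall z \near (0 : R[i]), differentiable (f \o sphere_inv) z.

Definition sphere_analytic_on (V : normedModType R[i]) (D : set sphere)
    (f : sphere -> V) : Prop :=
  forall s, D s -> sphere_analytic_at f s.

(* Complex indices for which v_n is defined: the natural numbers, and the
   finite points outside the disc, where v_n is the analytic extension. *)
Definition valid_index (nu : R) (n : R[i]) : Prop :=
  (exists k : nat, n = k%:R) \/ outside_disc nu (Some n).

End RiemannSphere.
Arguments sphere R : clear implicits.

(* Main.v *)
Require Import Defs.
From mathcomp Require Import ring lra.

(** Fix [x] in the cube. In the variable [z = 1 / n] the function
    [g z = phi (v_n x)] is holomorphic on the closed disc of radius [1 / nu],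
    including the centre, which is the point at infinity of the sphere, and is
    bounded there by the norm of [phi]. The operator only uses the values
    [g (1 / n)]. Finitely many of them, for [n < N] with [N] at least
    [4 * nu], are kept. All the others are values of [g] in a disc four times
    smaller, and there [g] is approximated by its Lagrange interpolant at the
    [M] points [1 / N, ..., 1 / (N + M - 1)], with an error at most
    [(8 / 3) * |phi| * (2 / 3) ^ M] ([interpolation_error]). The
    coefficients [l_q (1 / n)] of the interpolation depend neither on [phi]
    nor on [x], so summing against the absolutely summable [w_n x] gives the
    weights [sum_n w_n x * l_q (1 / n)] and an error at most
    [W * (8 / 3) * |phi| * (2 / 3) ^ M] ([weighted_interpolation_error]).
    The number [M] needed for a given error is logarithmic ([node_count]), and
    the evaluation indices are the natural numbers below [N + M].

    The interpolation error is a contour integral: applying Cauchy's formula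
    at the point and at the nodes turns it into the mean of [g] against
    Hermite's kernel ([hermite_remainder]), in which the nodal polynomial at a
    point of the small disc is divided by its value on the large circle.

    Cauchy's formula ([cauchy_formula]) has to start from pointwise complex
    differentiability. In logarithmic coordinates, [f (exp (s + i t))] has a
    rectangle integral that vanishes by Goursat's quadrisection argument
    ([goursat]), and periodicity in [t] makes the integral over a circle
    independent of its radius ([circle_int_const]). Letting the radius tend to
    0 or to infinity evaluates the two integrals that enter the formula. *)

Set Implicit Arguments.
Unset Strict Implicit.
Unset Printing Implicit Defensive.

Local Open Scope classical_set_scope.
Local Open Scope ring_scope.
Local Open Scope complex_scope.

Local Notation normc := Normc.normc.

(** * Topology of the complex plane through the real-valued modulus *)

Section Modulus.
Context {R : realType}.
Implicit Types (z u : R[i]) (f : R[i] -> R[i]).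

Lemma normc_ge0 z : 0 <= normc z.
Proof. by case: z => a b; exact: sqrtr_ge0. Qed.

Lemma ler_normcD z u : normc (z + u) <= normc z + normc u.
Proof. exact: le_normcD. Qed.

Lemma normc_distC z u : normc (z - u) = normc (u - z).
Proof. by rewrite -opprB normcN. Qed.

Lemma ler_normcB z u : normc (z - u) <= normc z + normc u.
Proof. by rewrite (le_trans (ler_normcD _ _)) ?normcN. Qed.

Lemma lerB_normc z u : normc z - normc u <= normc (z - u).
Proof. by rewrite lerBlDr (le_trans _ (ler_normcD _ _)) ?subrK. Qed.

Lemma normc_eq0 z : (normc z == 0) = (z == 0).
Proof.
apply/eqP/eqP => [/Normc.eq0_normc//|->]; exact: Normc.normc0.
Qed.

Lemma normc_gt0 z : (0 < normc z) = (z != 0).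
Proof. by rewrite lt_neqAle normc_ge0 eq_sym normc_eq0 andbT. Qed.

Lemma normc_real (x : R) : normc x%:C = `|x|.
Proof. by rewrite /= expr0n addr0 sqrtr_sqr. Qed.

Lemma normcX z n : normc (z ^+ n) = normc z ^+ n.
Proof.
by elim: n => [|n IH]; rewrite ?expr0 ?Normc.normc1// !exprS Normc.normcM IH.
Qed.

Lemma normc_prod (I : Type) (s : seq I) (F : I -> R[i]) :
  normc (\prod_(i <- s) F i) = \prod_(i <- s) normc (F i).
Proof.
elim: s => [|i s IH]; first by rewrite !big_nil Normc.normc1.
by rewrite !big_cons Normc.normcM IH.
Qed.

Lemma normc_sum (I : Type) (s : seq I) (F : I -> R[i]) :
  normc (\sum_(i <- s) F i) <= \sum_(i <- s) normc (F i).
Proof.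
elim: s => [|i s IH]; first by rewrite !big_nil Normc.normc0.
by rewrite !big_cons (le_trans (ler_normcD _ _)) ?lerD2l.
Qed.

Lemma normc_lecR z (e : R) : (`|z| <= e%:C) = (normc z <= e).
Proof. by rewrite lecR. Qed.

Lemma Re_le_normc z : `|complex.Re z| <= normc z.
Proof.
case: z => a b /=; rewrite -sqrtr_sqr; apply: ler_wsqrtr.
by rewrite lerDl sqr_ge0.
Qed.

Lemma Im_le_normc z : `|complex.Im z| <= normc z.
Proof.
case: z => a b /=; rewrite -sqrtr_sqr; apply: ler_wsqrtr.
by rewrite lerDr sqr_ge0.
Qed.

Lemma normc_le_ReIm z : normc z <= `|complex.Re z| + `|complex.Im z|.
Proof.
case: z => a b /=; rewrite -[leRHS]ger0_norm ?addr_ge0//.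
rewrite -[leRHS]sqrtr_sqr; apply: ler_wsqrtr.
rewrite sqrrD !real_normK ?num_real// lerD2r lerDl.
by rewrite mulrn_wge0 ?mulr_ge0.
Qed.

Lemma posc_real (e : R[i]) : 0 < e -> exists2 d : R, 0 < d & e = d%:C.
Proof.
by case: e => a b; rewrite ltcE /= => /andP[/eqP -> a0]; exists a.
Qed.

(** Neighbourhoods in the complex plane are generated by balls whose radius is
    a complex number; this and the next lemmas replace it by a real radius, so
    that all estimates below take place in [R]. *)
Lemma nbhs_normcP (z : R[i]) (P : R[i] -> Prop) :
  nbhs z P <-> exists2 e : R, 0 < e & forall u, normc (u - z) < e -> P u.
Proof.
split.
  move=> /nbhs_ballP[e /posc_real[d d0 ->] sub].
  exists d => // u zu; apply: sub.
  by rewrite -ball_normE /= -normrN opprB; rewrite ltcR.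
move=> [e e0 sub]; apply/nbhs_ballP; exists e%:C; first by rewrite /= ltcR.
by move=> u; rewrite -ball_normE /= -normrN opprB ltcR => /sub.
Qed.

Lemma continuous_normcP f z : {for z, continuous f} <->
  forall e : R, 0 < e ->
    exists2 d : R, 0 < d & forall u, normc (u - z) < d -> normc (f u - f z) < e.
Proof.
split.
  move=> cf e e0; apply/nbhs_normcP.
  by apply: (cf (fun y => normc (y - f z) < e)); apply/nbhs_normcP; exists e.
move=> H A /nbhs_normcP[e /H[d d0 fd] sub]; apply/nbhs_normcP.
by exists d => // u /fd/sub.
Qed.

(** The only consequence of complex differentiability used by Goursat's
    argument: near [z], [f] is affine up to an error small relative to
    [u - z]. *)
Lemma differentiable_normcP f z : differentiable f z ->
  exists c, forall e : R, 0 < e -> exists2 d : R, 0 < d &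
    forall u, normc (u - z) < d ->
      normc (f u - f z - c * (u - z)) <= e * normc (u - z).
Proof.
move=> df0; have df := @diff_derivable _ _ _ _ _ (1 : R[i]) df0.
exists ('D_1 f z) => e e0.
have /cvgrPdist_lt/(_ e%:C) :
    h^-1 *: ((f \o shift z) (h *: (1 : R[i])) - f z) @[h --> 0^'] --> 'D_1 f z.
  exact: df.
rewrite ltcR => /(_ e0) /nbhs_normcP[d d0 H].
exists d => // u ud.
have [->|uz] := eqVneq u z; first by rewrite !subrr mulr0 subr0 Normc.normc0 mulr0.
have uz0 : u - z != 0 by rewrite subr_eq0.
have := H (u - z); rewrite subr0 => /(_ ud uz0).
rewrite /= ltcR => /ltW le.
have -> : f u - f z - 'D_1 f z * (u - z) =
   - ('D_1 f z - (u - z)^-1 * (f u - f z)) * (u - z).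
  by field.
rewrite Normc.normcM normcN ler_wpM2r ?normc_ge0//.
move: le; rewrite /GRing.scale/= mulr1 subrK //.
Qed.

End Modulus.

(** * Integrals of complex-valued functions over a segment *)

Section RealIntegral.
Context {R : realType}.
Implicit Types (f g : R -> R) (a b c m k M : R).

Definition rint a b f : R := \int[lebesgue_measure]_(x in `[a, b]) f x.

Lemma rint_integrable a b f : {within `[a, b], continuous f} ->
  (@lebesgue_measure R).-integrable `[a, b] (EFin \o f).
Proof. by move=> cf; apply: continuous_compact_integrable => //;
  exact: segment_compact. Qed.

Lemma rintD a b f g : {within `[a, b], continuous f} ->
  {within `[a, b], continuous g} ->
  rint a b (fun x => f x + g x) = rint a b f + rint a b g.
Proof. by move=> cf cg; apply: RintegralD => //; exact: rint_integrable. Qed.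

Lemma rintZ a b k f : {within `[a, b], continuous f} ->
  rint a b (fun x => k * f x) = k * rint a b f.
Proof. by move=> cf; apply: RintegralZl => //; exact: rint_integrable. Qed.

Lemma rint_cst a b k : a <= b -> rint a b (fun=> k) = k * (b - a).
Proof.
move=> ab; rewrite /rint Rintegral_cst//= lebesgue_measure_itv/= lte_fin.
move: ab; rewrite le_eqVlt => /predU1P[->|->//].
by rewrite ltxx subrr.
Qed.

Lemma rint_split a b c f : a <= b -> b <= c -> {within `[a, c], continuous f} ->
  rint a c f = rint a b f + rint b c f.
Proof.
move=> ab bc cf.
have /rint_integrable fi := cf.
have := @Rintegral_itvB R f (BLeft a) (BRight c) b fi.
rewrite !bnd_simp => /(_ ab bc) /eqP; rewrite subr_eq addrC => /eqP.
rewrite Rintegral_itv_obnd_cbnd//.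
apply: integrableS fi => //.
by apply: subset_itvr; rewrite bnd_simp.
Qed.

Lemma rint_bound a b f M : a <= b -> {within `[a, b], continuous f} ->
  (forall x, a <= x <= b -> `|f x| <= M) -> `|rint a b f| <= M * (b - a).
Proof.
move=> ab cf fM.
have /rint_integrable fi := cf.
rewrite -rint_cst//; apply: le_trans (le_normr_Rintegral _ fi) _ => //.
apply: le_Rintegral => //.
- by have := integrable_norm fi.
- by apply: rint_integrable => x; exact: cst_continuous.
Qed.

End RealIntegral.

Section ComplexIntegral.
Context {R : realType}.
Implicit Types (f g : R -> R[i]) (a b c M : R) (k : R[i]).

(** The integral is taken separately on real and imaginary parts; this costs a
    factor 2 in [cint_bound], harmless below because every bound is used up to
    a constant. *)
Definition cint a b f : R[i] :=
  rint a b (fun x => complex.Re (f x)) +i* rint a b (fun x => complex.Im (f x)).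

Definition cont_seg a b f :=
  {within `[a, b], continuous (fun x => complex.Re (f x))} /\
  {within `[a, b], continuous (fun x => complex.Im (f x))}.

Lemma cont_seg_normcP a b f :
  (forall x, a <= x <= b -> forall e : R, 0 < e -> exists2 d : R, 0 < d &
     forall y, `|y - x| < d -> normc (f y - f x) < e) -> cont_seg a b f.
Proof.
move=> H; split; apply: continuous_in_subspaceT => x;
  rewrite inE/= in_itv/= => /H{}H; apply/cvgrPdist_lt => e /H[d d0 fd];
  apply/nbhs_ballP; exists d => //= y;
  rewrite /ball/= -normrN opprB => /fd; apply: le_lt_trans;
  rewrite -normrN opprB.
  by rewrite -raddfB; exact: Re_le_normc.
by rewrite -raddfB; exact: Im_le_normc.
Qed.

Lemma ReD (z u : R[i]) : complex.Re (z + u) = complex.Re z + complex.Re u.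
Proof. by case: z; case: u. Qed.

Lemma ImD (z u : R[i]) : complex.Im (z + u) = complex.Im z + complex.Im u.
Proof. by case: z; case: u. Qed.

Lemma cont_seg_cst a b k : cont_seg a b (fun=> k).
Proof. by split => x; exact: cst_continuous. Qed.

Lemma cont_segD a b f g : cont_seg a b f -> cont_seg a b g ->
  cont_seg a b (fun x => f x + g x).
Proof.
move=> [fr fi] [gr gi]; split.
  rewrite (_ : (fun x => _) = fun x => complex.Re (f x) + complex.Re (g x)).
    by move=> x; apply: cvgD; [exact: fr|exact: gr].
  by apply/funext => x; rewrite ReD.
rewrite (_ : (fun x => _) = fun x => complex.Im (f x) + complex.Im (g x)).
  by move=> x; apply: cvgD; [exact: fi|exact: gi].
by apply/funext => x; rewrite ImD.
Qed.

Lemma cont_segZ a b k f : cont_seg a b f -> cont_seg a b (fun x => k * f x).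
Proof.
case: k => kr ki [fr fi]; split.
  rewrite (_ : (fun x => _) =
    fun x => kr * complex.Re (f x) + (- ki) * complex.Im (f x)); last first.
    by apply/funext => x; case: (f x) => ? ? /=; rewrite mulNr.
  move=> x; apply: cvgD; apply: cvgMr; [exact: fr|exact: fi].
rewrite (_ : (fun x => _) =
  fun x => kr * complex.Im (f x) + ki * complex.Re (f x)); last first.
  by apply/funext => x; case: (f x) => ? ? /=.
move=> x; apply: cvgD; apply: cvgMr; [exact: fi|exact: fr].
Qed.

Lemma cont_segS a b a' b' f : a <= a' -> b' <= b -> cont_seg a b f -> cont_seg a' b' f.
Proof.
move=> aa bb [fr fi]; split; [move: fr|move: fi];
  apply: continuous_subspaceW; apply: subset_itv; by rewrite bnd_simp.
Qed.

Lemma cintD a b f g : cont_seg a b f -> cont_seg a b g ->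
  cint a b (fun x => f x + g x) = cint a b f + cint a b g.
Proof.
move=> [fr fi] [gr gi]; apply/eqP; rewrite eq_complex; apply/andP; split;
  apply/eqP; rewrite ?ReD ?ImD /= -rintD//; congr rint; apply/funext => x;
  by rewrite ?ReD ?ImD.
Qed.

Lemma cintZ a b k f : cont_seg a b f ->
  cint a b (fun x => k * f x) = k * cint a b f.
Proof.
case: k => kr ki [fr fi].
have c1 (q : R) (h : R -> R) : {within `[a, b], continuous h} ->
    {within `[a, b], continuous (fun x => q * h x)}.
  by move=> ch x; apply: cvgMr; exact: ch.
apply/eqP; rewrite eq_complex /= -mulNr -!rintZ// -!rintD//; try exact: c1.
apply/andP; split; apply/eqP; congr rint; apply/funext => x.
  by case: (f x) => ? ? /=; rewrite mulNr.
by case: (f x).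
Qed.

Lemma cintB a b f g : cont_seg a b f -> cont_seg a b g ->
  cint a b (fun x => f x - g x) = cint a b f - cint a b g.
Proof.
move=> cf cg.
rewrite -[in RHS]mulN1r -(cintZ (-1) cg) -cintD//; last exact: cont_segZ.
by congr cint; apply/funext => x; rewrite mulN1r.
Qed.

Lemma cint_cst a b k : a <= b -> cint a b (fun=> k) = k * (b - a)%:C.
Proof.
move=> ab; rewrite /cint !rint_cst//; case: k => kr ki /=.
by apply/eqP; rewrite eq_complex/= !mulr0 subr0 add0r !eqxx.
Qed.

Lemma cint_split a b c f : a <= b -> b <= c -> cont_seg a c f ->
  cint a c f = cint a b f + cint b c f.
Proof. by move=> ab bc [fr fi];
  rewrite /cint (rint_split ab bc fr) (rint_split ab bc fi). Qed.

Lemma cint_bound a b f M : a <= b -> cont_seg a b f ->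
  (forall x, a <= x <= b -> normc (f x) <= M) ->
  normc (cint a b f) <= 2 * M * (b - a).
Proof.
move=> ab [fr fi] fM; rewrite (le_trans (normc_le_ReIm _))//=.
rewrite -mulrA mulrDl mul1r lerD// rint_bound// => x /fM; apply: le_trans.
  exact: Re_le_normc.
exact: Im_le_normc.
Qed.

Lemma eq_cint a b f g : (forall x, a <= x <= b -> f x = g x) ->
  cint a b f = cint a b g.
Proof.
by move=> fg; congr Complex; apply: eq_Rintegral => x;
  rewrite inE/= in_itv/= => /fg ->.
Qed.

(** The form in which integrals are estimated below: a function close to a
    constant has an integral close to that of the constant, so that no
    primitive is ever needed. *)
Lemma cint_near_cst a b f k M : a <= b -> cont_seg a b f ->
  (forall x, a <= x <= b -> normc (f x - k) <= M) ->
  normc (cint a b f - k * (b - a)%:C) <= 2 * M * (b - a).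
Proof.
move=> ab cf fM; rewrite -cint_cst// -cintB//; last exact: cont_seg_cst.
by apply: cint_bound => //; apply: cont_segD => //; exact: cont_seg_cst.
Qed.

End ComplexIntegral.

(** * Goursat's theorem for rectangles *)

Section Quadrisection.
Context {R : realType}.

Lemma nested_intervals (a h : nat -> R) :
  (forall n, 0 <= h n) -> (forall n, a n <= a n.+1) ->
  (forall n, a n.+1 + h n.+1 <= a n + h n) ->
  exists s, forall n, a n <= s <= a n + h n.
Proof.
move=> h0 inc dec.
have incn m n : (m <= n)%N -> a m <= a n by move=> mn;
  exact: (proj1 (nondecreasing_seqP _) inc).
have decn m n : (m <= n)%N -> a n + h n <= a m + h m.
  elim: n => [|n IH]; first by rewrite leqn0 => /eqP ->.
  by rewrite leq_eqVlt => /predU1P[->//|/IH]; apply: le_trans; exact: dec.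
have le m n : a m <= a n + h n.
  have [mn|nm] := leqP m n; first by rewrite (le_trans (incn _ _ mn))// lerDl.
  by rewrite (le_trans _ (decn _ _ (ltnW nm)))// lerDl.
exists (sup (range a)) => n; apply/andP; split.
  apply: ub_le_sup; last by exists n.
  by exists (a 0%N + h 0%N) => _ [m _ <-].
apply: ge_sup; first by exists (a 0%N), 0%N.
by move=> _ [m _ <-].
Qed.

Lemma halving_small (h e : R) : 0 < h -> 0 < e -> exists n, h / 2 ^+ n < e.
Proof.
move=> h0 e0; exists (Num.truncn (h / e)).+1.
rewrite ltr_pdivrMr ?exprn_gt0// mulrC -ltr_pdivrMr//.
rewrite (lt_le_trans (truncnS_gt _))// -natrX ler_nat.
by rewrite ltnW// ltn_expl.
Qed.

(** A property inherited, at each step, by one of the four quarters of a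
    rectangle is inherited along a sequence of rectangles shrinking to a
    point; [k] is the common ratio of the sides. Rectangles are given by lower
    left corner and width [h], the height being [k * h]. *)
Lemma quadrisection (k : R) (P : R -> R -> R -> Prop) (a0 c0 h0 : R) :
  0 < k -> 0 < h0 ->
  (forall a c h, 0 < h -> a0 <= a -> a + h <= a0 + h0 -> c0 <= c ->
     c + k * h <= c0 + k * h0 -> P a c h ->
     exists i j : bool, P (a + i%:R * (h / 2)) (c + j%:R * (k * (h / 2))) (h / 2)) ->
  P a0 c0 h0 ->
  exists s t, [/\ a0 <= s <= a0 + h0, c0 <= t <= c0 + k * h0 &
    forall e, 0 < e -> exists a c h, P a c h /\
     [/\ 0 < h < e, a0 <= a <= s, s <= a + h <= a0 + h0, c0 <= c <= t &
      t <= c + k * h <= c0 + k * h0]].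
Proof.
move=> k0 h00 step P0.
pose inv (x : R * R * R) := [/\ 0 < x.2, a0 <= x.1.1 , x.1.1 + x.2 <= a0 + h0,
   c0 <= x.1.2 & x.1.2 + k * x.2 <= c0 + k * h0] /\ P x.1.1 x.1.2 x.2.
pose child (x y : R * R * R) := exists i j : bool, y =
  (x.1.1 + i%:R * (x.2 / 2), x.1.2 + j%:R * (k * (x.2 / 2)), x.2 / 2).
have /boolp.choice[nx nxP] x :
    exists y, inv x -> child x y /\ P y.1.1 y.1.2 y.2.
  have [ix|nix] := pselect (inv x); last by exists x.
  have [[x1 x2 x3 x4 x5] x6] := ix.
  have [i [j Pij]] := step _ _ _ x1 x2 x3 x4 x5 x6.
  by eexists=> _; split; [exists i, j; reflexivity|].
have child_inv x y : inv x -> child x y -> P y.1.1 y.1.2 y.2 ->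
   [/\ inv y, x.1.1 <= y.1.1, y.1.1 + y.2 <= x.1.1 + x.2,
    x.1.2 <= y.1.2 & y.1.2 + k * y.2 <= x.1.2 + k * x.2].
  move=> [[x1 x2 x3 x4 x5] x6] [i [j ye]] Py.
  have kx0 : 0 < k * x.2 by rewrite mulr_gt0.
  have h20 : 0 < y.2 by rewrite ye /= divr_gt0.
  have [y1 y2] : x.1.1 <= y.1.1 /\ y.1.1 + y.2 <= x.1.1 + x.2.
    by rewrite ye; case: i {ye} => /=; rewrite ?mul1r ?mul0r; lra.
  have [y3 y4] : x.1.2 <= y.1.2 /\ y.1.2 + k * y.2 <= x.1.2 + k * x.2.
    by rewrite ye mulrA; case: j {ye} => /=; rewrite ?mul1r ?mul0r; lra.
  by do 3 (split => //); lra.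
pose u n := iter n nx (a0, c0, h0).
have uinv n : inv (u n).
  elim: n => [|n IH]; first by split=> //; split.
  by have [cx Px] := nxP _ IH; have [] := child_inv _ _ IH cx Px.
have uS n : [/\ inv (u n.+1), (u n).1.1 <= (u n.+1).1.1,
    (u n.+1).1.1 + (u n.+1).2 <= (u n).1.1 + (u n).2,
    (u n).1.2 <= (u n.+1).1.2 &
    (u n.+1).1.2 + k * (u n.+1).2 <= (u n).1.2 + k * (u n).2].
  by have [cx Px] := nxP _ (uinv n); exact: child_inv.
have uh n : (u n).2 = h0 / 2 ^+ n.
  elim: n => [|n IH]; first by rewrite expr0 divr1.
  have [[i [j /= ->]] _] := nxP _ (uinv n); rewrite /= -/(u n) IH exprS.
  by field; rewrite expf_neq0.
have [s sP] : exists s, forall n, (u n).1.1 <= s <= (u n).1.1 + (u n).2.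
  by apply: nested_intervals => n;
    [case: (uinv n) => [] [/ltW]|case: (uS n)|case: (uS n)].
have [t tP] : exists t, forall n, (u n).1.2 <= t <= (u n).1.2 + k * (u n).2.
  apply: (@nested_intervals (fun n => (u n).1.2) (fun n => k * (u n).2)) => n;
    [|by case: (uS n)..].
  by case: (uinv n) => [] [/ltW ? _ _ _ _] _; rewrite mulr_ge0 ?(ltW k0).
exists s, t; split; [exact: (sP 0%N)|exact: (tP 0%N)|].
move=> e e0; have [n ne] := halving_small h00 e0.
exists (u n).1.1, (u n).1.2, (u n).2.
have [[x1 x2 x3 x4 x5] x6] := uinv n.
have /andP[s1 s2] := sP n; have /andP[t1 t2] := tP n.
by split=> //; rewrite ?x1 ?x2 ?x3 ?x4 ?x5 ?s1 ?s2 ?t1 ?t2 // uh ne.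
Qed.

End Quadrisection.

Section Goursat.
Context {R : realType}.
Implicit Types (H : R[i] -> R[i]) (a b c d : R).

(** The integral of [H dz] over the boundary of [a, b] x [c, d], opposite
    sides being paired. With this pairing an affine function has constant
    integrands, which makes its integral vanish by [cint_cst] alone. *)
Definition rect_int H a b c d : R[i] :=
  (0 +i* 1) * cint c d (fun t => H (b +i* t) - H (a +i* t))
  - cint a b (fun s => H (s +i* d) - H (s +i* c)).

Definition cont_rect H a b c d := forall s t, a <= s <= b -> c <= t <= d ->
  {for s +i* t, continuous H}.

Lemma cont_rectS H a b c d a' b' c' d' : a <= a' -> b' <= b -> c <= c' -> d' <= d ->
  cont_rect H a b c d -> cont_rect H a' b' c' d'.
Proof.
move=> aa bb cc dd HC s t /andP[s1 s2] /andP[t1 t2]; apply: HC.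
  by rewrite (le_trans aa)//= (le_trans s2).
by rewrite (le_trans cc)//= (le_trans t2).
Qed.

Lemma cont_rect_vert H a b c d s : cont_rect H a b c d -> a <= s <= b ->
  cont_seg c d (fun t => H (s +i* t)).
Proof.
move=> HC sab; apply: cont_seg_normcP => t tcd e e0.
have /continuous_normcP/(_ e e0)[dl dl0 Hd] := HC _ _ sab tcd.
exists dl => // y yt; apply: Hd.
by rewrite /= subrr expr0n add0r sqrtr_sqr.
Qed.

Lemma cont_rect_hor H a b c d t : cont_rect H a b c d -> c <= t <= d ->
  cont_seg a b (fun s => H (s +i* t)).
Proof.
move=> HC tcd; apply: cont_seg_normcP => s sab e e0.
have /continuous_normcP/(_ e e0)[dl dl0 Hd] := HC _ _ sab tcd.
exists dl => // y yt; apply: Hd.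
by rewrite /= subrr expr0n addr0 sqrtr_sqr.
Qed.

Lemma cont_segB a b (f g : R -> R[i]) : cont_seg a b f -> cont_seg a b g ->
  cont_seg a b (fun x => f x - g x).
Proof.
move=> cf cg; have /(cont_segD cf) := cont_segZ (-1) cg.
by under eq_fun do rewrite mulN1r.
Qed.

Lemma rect_int_split_h H a m b c d : a <= m -> m <= b -> c <= d ->
  cont_rect H a b c d -> rect_int H a b c d = rect_int H a m c d + rect_int H m b c d.
Proof.
move=> am mb cd HC.
have vc x : a <= x <= b -> cont_seg c d (fun t => H (x +i* t)) by exact: cont_rect_vert.
have cc : c <= c <= d by rewrite lexx.
have dd : c <= d <= d by rewrite lexx cd.
have ab := le_trans am mb.
rewrite /rect_int (cint_split am mb); last by apply: cont_segB;
  apply: cont_rect_hor HC _.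
rewrite !cintB; do ?[by apply: vc; rewrite ?lexx ?am ?mb ?ab].
- by ring.
all: by [exact: (cont_segS _ _ (cont_rect_hor HC dd))|exact: (cont_segS _ _
  (cont_rect_hor HC cc))].
Qed.

Lemma rect_int_split_v H a b c m d : a <= b -> c <= m -> m <= d ->
  cont_rect H a b c d -> rect_int H a b c d = rect_int H a b c m + rect_int H a b m d.
Proof.
move=> ab cm md HC.
have hc x : c <= x <= d -> cont_seg a b (fun t => H (t +i* x)) by exact: cont_rect_hor.
have aa : a <= a <= b by rewrite lexx.
have bb : a <= b <= b by rewrite lexx ab.
have cd := le_trans cm md.
rewrite /rect_int (cint_split cm md); last by apply: cont_segB;
  apply: cont_rect_vert HC _.
rewrite !cintB; do ?[by apply: hc; rewrite ?lexx ?cm ?md ?cd].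
- by ring.
all: by [exact: (cont_segS _ _ (cont_rect_vert HC aa))|exact: (cont_segS _ _
  (cont_rect_vert HC bb))].
Qed.

(** The rectangle integral of an affine function is zero, so only the distance
    of [H] to an affine function matters. *)
Lemma rect_int_near_affine H a b c d (A B : R[i]) (M : R) : a <= b -> c <= d ->
  cont_rect H a b c d ->
  (forall s t, a <= s <= b -> c <= t <= d ->
    normc (H (s +i* t) - (A + B * (s +i* t))) <= M) ->
  normc (rect_int H a b c d) <= 4 * M * ((b - a) + (d - c)).
Proof.
move=> ab cd HC HM.
have aa : a <= a <= b by rewrite lexx.
have bb : a <= b <= b by rewrite lexx ab.
have cc : c <= c <= d by rewrite lexx.
have dd : c <= d <= d by rewrite lexx cd.
have E1 : normc (cint c d (fun t => H (b +i* t) - H (a +i* t)) -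
  B * (b - a)%:C * (d - c)%:C) <= 2 * (M + M) * (d - c).
  apply: cint_near_cst => //; first by apply: cont_segB; apply: cont_rect_vert HC _.
  move=> t tcd; apply: le_trans (lerD (HM _ _ bb tcd) (HM _ _ aa tcd)).
  apply: le_trans (ler_normcB _ _); rewrite le_eqVlt; apply/orP; left; apply/eqP;
    congr normc.
  have -> : (b - a)%:C = b +i* t - a +i* t by apply/eqP;
    rewrite eq_complex /= subrr !eqxx.
  by ring.
have E2 : normc (cint a b (fun s => H (s +i* d) - H (s +i* c)) -
  B * (0 +i* (d - c)) * (b - a)%:C) <= 2 * (M + M) * (b - a).
  apply: cint_near_cst => //; first by apply: cont_segB; apply: cont_rect_hor HC _.
  move=> t tcd; apply: le_trans (lerD (HM _ _ tcd dd) (HM _ _ tcd cc)).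
  apply: le_trans (ler_normcB _ _); rewrite le_eqVlt; apply/orP; left; apply/eqP;
    congr normc.
  have -> : 0 +i* (d - c) = t +i* d - t +i* c by apply/eqP;
    rewrite eq_complex /= subrr !eqxx.
  by ring.
set X := cint c d _ in E1; set Y := cint a b _ in E2.
have -> : rect_int H a b c d = (0 +i* 1) * (X - B * (b - a)%:C * (d - c)%:C) -
   (Y - B * (0 +i* (d - c)) * (b - a)%:C).
  rewrite /rect_int -/X -/Y.
  have -> : 0 +i* (d - c) = (0 +i* 1) * (d - c)%:C.
    by apply/eqP; rewrite eq_complex /=; apply/andP; split; apply/eqP; ring.
  by ring.
apply: le_trans (ler_normcB _ _) _.
rewrite Normc.normcM (_ : normc (0 +i* 1) = 1); last
  by rewrite /= expr0n expr1n add0r sqrtr1.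
lra.
Qed.

Lemma rect_int_quarter H a m b c n d : a <= m -> m <= b -> c <= n -> n <= d ->
  cont_rect H a b c d ->
  normc (rect_int H a b c d) <=
    normc (rect_int H a m c n) + normc (rect_int H a m n d) +
    (normc (rect_int H m b c n) + normc (rect_int H m b n d)).
Proof.
move=> am mb cn nd HC.
rewrite (rect_int_split_h am mb (le_trans cn nd) HC).
rewrite (rect_int_split_v am cn nd); last exact: (cont_rectS _ _ _ _ HC).
rewrite (rect_int_split_v mb cn nd); last exact: (cont_rectS _ _ _ _ HC).
apply: le_trans (ler_normcD _ _) _.
exact: lerD (ler_normcD _ _) (ler_normcD _ _).
Qed.

(** The identity plus a jump of size 1 at each side of [e]: an increasing
    function charging the vertical line of abscissa [e]. *)
Definition jump e s : R := s + Num.sg (s - e).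

Lemma jump_ge e x y : x <= y -> y - x <= jump e y - jump e x.
Proof.
move=> xy; rewrite /jump.
suff : Num.sg (x - e) <= Num.sg (y - e) by lra.
have [xe|xe|xe] := ltrgtP x e.
- rewrite ltr0_sg ?subr_lt0//; case: sgrP; lra.
- by rewrite !gtr0_sg ?subr_gt0//; lra.
- rewrite xe subrr sgr0; case: sgrP; lra.
Qed.

Lemma jump_across e x y : x < y -> x <= e <= y -> 1 <= jump e y - jump e x.
Proof.
move=> xy /andP[xe ye]; rewrite /jump.
suff : Num.sg (x - e) + 1 <= Num.sg (y - e) by lra.
have [{}xe|xe'] := ltP x e.
  rewrite ltr0_sg ?subr_lt0//; case: sgrP; lra.
by rewrite (_ : x = e) ?subrr ?sgr0 ?gtr0_sg ?subr_gt0//; lra.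
Qed.

(** The area of a rectangle, plus a mass proportional to the length of the
    part of the line of abscissa [e] that it contains. Goursat's argument
    compares rectangle integrals with this additive mass instead of the area:
    near the line, where only continuity is known, a rectangle integral is
    small relative to the side, hence to the mass, but not to the area. *)
Definition jmass e a b c d : R := (d - c) * (jump e b - jump e a).

Lemma jmass_quarter e a m b c n d :
  jmass e a b c d = jmass e a m c n + jmass e a m n d +
    (jmass e m b c n + jmass e m b n d).
Proof. by rewrite /jmass; ring. Qed.

(** Near a point where [H] is differentiable the rectangle integral is
    o(area), and near a point of the line of abscissa [e] it is o(side) by
    continuity; both are negligible with respect to [jmass]. *)
Lemma goursat_local H a b c d e k s t eps : cont_rect H a b c d ->
  a <= s <= b -> c <= t <= d ->
  (s != e -> differentiable H (s +i* t)) -> 0 < k -> 0 < eps ->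
  exists2 dl : R, 0 < dl & forall a' c' h, 0 < h < dl ->
    a <= a' <= s -> s <= a' + h <= b -> c <= c' <= t -> t <= c' + k * h <= d ->
    normc (rect_int H a' (a' + h) c' (c' + k * h)) <=
      eps * jmass e a' (a' + h) c' (c' + k * h).
Proof.
move=> HC sab tcd HD k0 eps0.
have near a' c' h (dl : R) : 0 < h < dl / (1 + k) ->
    a' <= s -> s <= a' + h -> c' <= t -> t <= c' + k * h ->
    forall x y, a' <= x <= a' + h -> c' <= y <= c' + k * h ->
    normc (x +i* y - s +i* t) <= (1 + k) * h < dl.
  move=> /andP[h0]; rewrite ltr_pdivlMr ?addr_gt0// =>
    hd as1 as2 ct1 ct2 x y /andP[x1 x2] /andP[y1 y2].
  rewrite mulrC hd andbT (le_trans (normc_le_ReIm _))//= mulrDr mulr1 (mulrC h) lerD//.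
    by rewrite ler_norml; lra.
  by rewrite ler_norml; apply/andP; split; lra.
have [se|se] := eqVneq s e.
  (* The sides add up to (1 + k) h, and the mass is at least the height k h. *)
  pose M := eps * k / (4 * (1 + k)).
  have M0 : 0 < M by rewrite divr_gt0 ?mulr_gt0 ?addr_gt0.
  have /continuous_normcP/(_ M M0)[dl dl0 Hd] := HC _ _ sab tcd.
  exists (dl / (1 + k)); first by rewrite divr_gt0// addr_gt0.
  move=> a' c' h hdl /andP[a1 a2] /andP[b1 b2] /andP[c1 c2] /andP[d1 d2].
  have /andP[h0 _] := hdl.
  have kh0 : 0 < k * h by rewrite mulr_gt0.
  have L := @rect_int_near_affine H a' (a' + h) c' (c' + k * h) (H (s +i* t)) 0 M.
  apply: le_trans (L _ _ _ _) _ => {L}; rewrite ?lerDl ?(ltW h0) ?(ltW kh0)//.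
  - exact: (cont_rectS _ _ _ _ HC).
  - move=> x y xx yy; rewrite mul0r addr0; apply/ltW/Hd.
    by have /andP[+] := near _ _ _ _ hdl a2 b1 c2 d1 _ _ xx yy; apply: le_lt_trans.
  rewrite /jmass -[(a' + h) - a']addrAC [(c' + k * h) - c']addrAC !subrr !add0r.
  have -> : 4 * M * (h + k * h) = eps * (k * h * 1).
    by rewrite /M; field; rewrite gt_eqF// addr_gt0.
  rewrite ler_pM2l// ler_pM2l// jump_across ?ltrDl//.
  by rewrite -se a2 b1.
(* The error is at most M (1 + k) h on sides adding up to (1 + k) h, and the
   area is k h^2. *)
pose M := eps * k / (4 * (1 + k) ^+ 2).
have M0 : 0 < M by rewrite divr_gt0 ?mulr_gt0 ?exprn_gt0 ?addr_gt0.
have /differentiable_normcP[B /(_ M M0)[dl dl0 Hd]] := HD se.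
exists (dl / (1 + k)); first by rewrite divr_gt0// addr_gt0.
move=> a' c' h hdl /andP[a1 a2] /andP[b1 b2] /andP[c1 c2] /andP[d1 d2].
have /andP[h0 _] := hdl.
have kh0 : 0 < k * h by rewrite mulr_gt0.
have L := @rect_int_near_affine H a' (a' + h) c' (c' + k * h) (H (s +i* t) -
  B * (s +i* t)) B (M * ((1 + k) * h)).
apply: le_trans (L _ _ _ _) _ => {L}; rewrite ?lerDl ?(ltW h0) ?(ltW kh0)//.
- exact: (cont_rectS _ _ _ _ HC).
- move=> x y xx yy.
  have /andP[n1 n2] := near _ _ _ _ hdl a2 b1 c2 d1 _ _ xx yy.
  have := Hd (x +i* y) (le_lt_trans n1 n2).
  have -> : H (x +i* y) - H (s +i* t) - B * (x +i* y - s +i* t) =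
     H (x +i* y) - (H (s +i* t) - B * (s +i* t) + B * (x +i* y)) by ring.
  move=> /le_trans; apply.
  by rewrite ler_pM2l.
rewrite /jmass -[(a' + h) - a']addrAC [(c' + k * h) - c']addrAC !subrr !add0r.
have -> : 4 * (M * ((1 + k) * h)) * (h + k * h) = eps * (k * h * h).
  by rewrite /M; field; rewrite gt_eqF// addr_gt0.
rewrite ler_pM2l// ler_pM2l//.
apply: le_trans (jump_ge e _); last by rewrite lerDl ltW.
by rewrite addrAC subrr add0r.
Qed.

(** If the integral were nonzero it would exceed a small multiple of the mass
    of the rectangle; by additivity this excess would pass to a quarter, then
    to arbitrarily small rectangles around one point, against [goursat_local].
    Allowing an exceptional vertical line, on which continuity is enough,
    removes the singularity of the difference quotient in Cauchy's formula. *)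
Lemma goursat H a b c d e : a < b -> c < d -> cont_rect H a b c d ->
  (forall s t, a <= s <= b -> c <= t <= d -> s != e -> differentiable H (s +i* t)) ->
  rect_int H a b c d = 0.
Proof.
move=> ab cd HC HD.
have [k [h [k0 h0 bE dE]]] : exists k h, [/\ 0 < k, 0 < h, b = a + h & d = c + k * h].
  exists ((d - c) / (b - a)), (b - a).
  by rewrite divr_gt0 ?subr_gt0// divfK ?gt_eqF ?subr_gt0// !subrKC.
apply/eqP; rewrite -normc_eq0; apply/eqP/le_anti; rewrite normc_ge0 andbT.
rewrite leNgt; apply/negP => gt0.
have mu0 : 0 < jmass e a b c d.
  by rewrite mulr_gt0 ?subr_gt0//; have := jump_ge e (ltW ab); rewrite -subr_gt0; lra.
have [eps eps0 Peps] : exists2 eps, 0 < eps & eps * jmass e a b c d <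
  normc (rect_int H a b c d).
  exists (normc (rect_int H a b c d) / (2 * jmass e a b c d)).
    by rewrite divr_gt0// mulr_gt0.
  have -> : normc (rect_int H a b c d) / (2 * jmass e a b c d) * jmass e a b c d =
      normc (rect_int H a b c d) / 2 by field; rewrite gt_eqF.
  by rewrite ltr_pdivrMr// ltr_pMr// ltr1n.
pose P a c h : Prop := eps * jmass e a (a + h) c (c + k * h) <
  normc (rect_int H a (a + h) c (c + k * h)).
rewrite bE dE in Peps.
have [a' c' h' h'0 a1 a2 c1 c2 P1|//|s [t [sab tcd loc]]] := @quadrisection R k P a c
  h k0 h0.
  have kh0 : 0 < k * h' by rewrite mulr_gt0.
  have HC' : cont_rect H a' (a' + h') c' (c' + k * h').
    by apply: cont_rectS HC => //; rewrite ?bE ?dE.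
  have am : a' <= a' + h' / 2 by rewrite lerDl divr_ge0// ltW.
  have mE : a' + h' / 2 + h' / 2 = a' + h' by rewrite -addrA -splitr.
  have mb : a' + h' / 2 <= a' + h' by rewrite -mE lerDl divr_ge0// ltW.
  have cn : c' <= c' + k * (h' / 2) by rewrite lerDl mulr_ge0 ?divr_ge0// ltW.
  have nE : c' + k * (h' / 2) + k * (h' / 2) = c' + k * h'
    by rewrite -addrA -mulrDr -splitr.
  have nd : c' + k * (h' / 2) <= c' + k * h'
    by rewrite -nE lerDl mulr_ge0 ?divr_ge0// ltW.
  have Q := rect_int_quarter am mb cn nd HC'.
  apply: contrapT => nP.
  have {}nP (i j : bool) : ~ P (a' + i%:R * (h' / 2)) (c' + j%:R * (k * (h' / 2)))
    (h' / 2).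
    by move=> ?; apply: nP; exists i, j.
  have := P1; rewrite /P ltNge => /negP; apply.
  apply: le_trans Q _.
  rewrite (jmass_quarter _ _ (a' + h' / 2) _ _ (c' + k * (h' / 2))) !mulrDr.
  have /negP := nP false false; rewrite !mul0r !addr0 -leNgt => e1.
  have /negP := nP false true; rewrite !mul0r !addr0 mul1r -leNgt nE => e2.
  have /negP := nP true false; rewrite !mul0r !addr0 mul1r -leNgt mE => e3.
  have /negP := nP true true; rewrite !mul1r -leNgt mE nE => e4.
  exact: lerD (lerD e1 e2) (lerD e3 e4).
rewrite -bE -dE in sab tcd loc.
have [dl dl0 Hl] := goursat_local HC sab tcd (HD _ _ sab tcd) k0 eps0.
have [a' [c' [h' [+ [h1 h2 h3 h4 h5]]]]] := loc dl dl0.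
by rewrite /P ltNge Hl.
Qed.

End Goursat.

(** * The complex exponential *)

Section Cexp.
Context {R : realType}.
Implicit Types (z u : R[i]).

Lemma is_derive0_normP (f : R -> R) (l : R) : is_derive (0 : R) 1 f l ->
  forall e : R, 0 < e -> exists2 d : R, 0 < d &
    forall x, `|x| < d -> `|f x - f 0 - l * x| <= e * `|x|.
Proof.
move=> [df fl] e e0.
have /cvgrPdist_lt/(_ e e0) :
    h^-1 *: ((f \o shift 0) (h *: (1 : R)) - f 0) @[h --> 0^'] --> l.
  by rewrite -fl; exact: df.
move=> /nbhs_ballP[d /= d0 H]; exists d => // x xd.
have [->|x0] := eqVneq x 0; first by rewrite subrr mulr0 subr0 normr0 mulr0.
have := H x; rewrite /ball/= sub0r normrN => /(_ xd x0).
rewrite /= addr0 /GRing.scale/= mulr1 => /ltW le.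
have -> : f x - f 0 - l * x = - (l - x^-1 * (f x - f 0)) * x by field.
by rewrite normrM normrN ler_wpM2r.
Qed.

Lemma cexpD z u : cexp (z + u) = cexp z * cexp u.
Proof.
case: z u => [a b] [c d]; rewrite /cexp /= expRD cosD sinD.
by apply/eqP; rewrite eq_complex /=; apply/andP; split; apply/eqP; ring.
Qed.

Lemma normc_cexp z : normc (cexp z) = expR (complex.Re z).
Proof.
rewrite /cexp /= !exprMn -mulrDr cos2Dsin2 mulr1 sqrtr_sqr.
by rewrite ger0_norm// expR_ge0.
Qed.

Lemma cexp_near0 (e : R) : 0 < e -> exists2 d : R, 0 < d &
  forall u, normc u < d -> normc (cexp u - 1 - u) <= e * normc u.
Proof.
move=> e0.
(* Real and imaginary parts together cost at most 8 e' times the modulus. *)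
pose e' := Num.min 1 (e / 8).
have e'0 : 0 < e' by rewrite lt_min ltr01/= divr_gt0.
have e'1 : e' <= 1 by rewrite ge_min lexx.
have e'e : 8 * e' <= e by rewrite -ler_pdivlMl// mulrC ge_min lexx orbT.
have [d1 d10 H1] := is_derive0_normP (is_derive_expR 0) e'0.
have [d2 d20 H2] := is_derive0_normP (is_derive_cos 0) e'0.
have [d3 d30 H3] := is_derive0_normP (is_derive_sin 0) e'0.
exists (Num.min (Num.min d1 d2) (Num.min d3 (e' / 2))).
  by rewrite !lt_min d10 d20 d30 divr_gt0.
move=> [x y]; rewrite !lt_min => /andP[/andP[n1 n2] /andP[n3 n4]].
have xn := Re_le_normc (x +i* y); have yn := Im_le_normc (x +i* y).
rewrite [complex.Re _]/= in xn; rewrite [complex.Im _]/= in yn.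
set N := normc _ in n1 n2 n3 n4 xn yn *.
have := H1 x (le_lt_trans xn n1); rewrite expR0 mul1r => {}H1.
have := H2 y (le_lt_trans yn n2); rewrite sin0 cos0 oppr0 mul0r subr0 => {}H2.
have := H3 y (le_lt_trans yn n3); rewrite sin0 cos0 mul1r subr0 => {}H3.
have N0 : 0 <= N by exact: normc_ge0.
clearbody N.
have b1 : e' * `|x| <= e' * N by rewrite ler_pM2l.
have b2 : e' * `|y| <= e' * N by rewrite ler_pM2l.
apply: le_trans (normc_le_ReIm _) _; rewrite /=.
have -> : expR x * cos y - 1 - x =
  (expR x - 1 - x) * cos y + (1 + x) * (cos y - 1) by ring.
have -> : expR x * sin y - 0 - y = (expR x - 1 - x + x) * sin y + (sin y - y) by ring.
have xe : `|x| <= e' / 2 by apply: le_trans xn _; exact: ltW.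
have ex1 : `|expR x - 1 - x + x| <= 2 * e'.
  apply: le_trans (ler_normD _ _) _.
  suff : e' * `|x| <= `|x| by lra.
  by rewrite ler_piMl.
have sy : `|sin y| <= 2 * N.
  rewrite -[sin y](subrK y); apply: le_trans (ler_normD _ _) _.
  suff : e' * N <= N by lra.
  by rewrite ler_piMl.
have t1 : `|(expR x - 1 - x) * cos y| <= e' * N.
  rewrite normrM -[leRHS]mulr1 ler_pM// ?(le_trans H1)//.
  by rewrite ler_norml cos_geN1 cos_le1.
have t2 : `|(1 + x) * (cos y - 1)| <= 2 * (e' * N).
  rewrite normrM ler_pM ?(le_trans H2)//.
  by apply: le_trans (ler_normD _ _) _; rewrite normr1; lra.
have t3 : `|(expR x - 1 - x + x) * sin y| <= 2 * e' * (2 * N).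
  by rewrite normrM ler_pM.
have t4 : `|sin y - y| <= e' * N by apply: le_trans H3 _.
have t5 : 8 * (e' * N) <= e * N by rewrite mulrA ler_wpM2r.
have := ler_normD ((expR x - 1 - x) * cos y) ((1 + x) * (cos y - 1)).
have := ler_normD ((expR x - 1 - x + x) * sin y) (sin y - y).
move: t1 t2 t3 t4 t5; move: (`|_|) (`|_|) (`|_|) (`|_|) (`|_|) (`|_|) => A B C D E F.
rewrite -(mulrA 2 e') (mulrCA e' 2); move: (e' * N) (e * N) => p q; lra.
Qed.

(** By the functional equation it is enough to differentiate at 0, where
    [cexp_near0] follows from the real derivatives of [expR], [cos] and
    [sin]. *)
Lemma differentiable_cexp z : differentiable (@cexp R) z.
Proof.
apply/derivable1_diffP.
apply/cvg_ex; exists (cexp z); apply/cvgrPdist_lt => e /posc_real[d d0 ->].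
have c0 : 0 < normc (cexp z) by rewrite normc_cexp expR_gt0.
have [dl dl0 H] := cexp_near0 (divr_gt0 d0 (mulr_gt0 (ltr0Sn _ 1) c0)).
apply/nbhs_normcP; exists dl => // h hd h0.
rewrite ltcR -/(normc _) /= /GRing.scale /= mulr1.
rewrite cexpD (mulrC (cexp h)).
have -> : cexp z - h^-1 * (cexp z * cexp h - cexp z) =
  - (h^-1 * (cexp z * (cexp h - 1 - h))) by field.
rewrite subr0 in hd.
rewrite normcN !Normc.normcM Normc.normcV ltr_pdivrMl ?normc_gt0//.
have := H _ hd.
rewrite -(ler_pM2l c0) => /le_lt_trans; apply.
have -> : normc (cexp z) * (d / (2 * normc (cexp z)) * normc h) = normc h * d / 2.
  by field; rewrite gt_eqF.
by rewrite ltr_pdivrMr// ltr_pMr ?ltr1n// mulr_gt0// normc_gt0.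
Qed.

Lemma cexp_2pi (s : R) : cexp (s +i* (2 * pi)) = cexp (s +i* 0).
Proof. by rewrite /cexp /= mulr_natl sin2pi cos2pi sin0 cos0. Qed.

End Cexp.

(** * Circle integrals and Cauchy's formula *)

Section Circle.
Context {R : realType}.
Implicit Types (z u a : R[i]) (f g : R[i] -> R[i]) (s S : R).

(** The integral of [f] over the circle of radius [expR s] with respect to the
    angle. The logarithm of the radius is used as a parameter because [s] and
    the angle then form a rectangle to which Goursat's theorem applies. *)
Definition circle_int f s : R[i] := cint 0 (2 * pi) (fun t => f (cexp (s +i* t))).

Definition cont_circle f s := forall z, normc z = expR s -> {for z, continuous f}.

Lemma twopi_gt0 : 0 < 2 * pi :> R.
Proof. by rewrite mulr_gt0// pi_gt0. Qed.

Lemma cont_circle_seg f s : cont_circle f s ->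
  cont_seg 0 (2 * pi) (fun t => f (cexp (s +i* t))).
Proof.
move=> cf; apply: (@cont_rect_vert _ (f \o @cexp R) s s 0 (2 * pi)); last
  by rewrite lexx.
move=> x t /andP[sx xs] _.
have -> : x = s by apply/le_anti; rewrite xs.
apply: continuous_comp; first exact/differentiable_continuous/differentiable_cexp.
by apply: cf; rewrite normc_cexp.
Qed.

Lemma cont_mul f g z : {for z, continuous f} -> {for z, continuous g} ->
  {for z, continuous (fun u => f u * g u)}.
Proof. by move=> cf cg; exact: (cvgM cf cg). Qed.

Lemma cont_add f g z : {for z, continuous f} -> {for z, continuous g} ->
  {for z, continuous (fun u => f u + g u)}.
Proof. by move=> cf cg; exact: (cvgD cf cg). Qed.

Lemma cont_id z : {for z, continuous (fun u : R[i] => u)}.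
Proof. exact: (@cvg_id _ (nbhs z)). Qed.

Lemma cont_cst (k : R[i]) z : {for z, continuous (fun _ : R[i] => k)}.
Proof. exact: cst_continuous. Qed.

(** In logarithmic coordinates an annulus is a rectangle of height 2 pi, and
    by periodicity the contributions of its two horizontal sides cancel:
    Goursat's theorem says that the two vertical sides, which are the two
    circles, have the same integral. The circle of radius [rho] becomes the
    exceptional line of [goursat]. *)
Lemma circle_int_const f s S (rho : R) : s < S ->
  (forall z, expR s <= normc z <= expR S -> {for z, continuous f}) ->
  (forall z, expR s <= normc z <= expR S -> normc z != rho -> differentiable f z) ->
  circle_int f s = circle_int f S.
Proof.
move=> sS fc fd.
have nz (x t : R) : s <= x <= S -> expR s <= normc (cexp (x +i* t)) <= expR S.
  by rewrite normc_cexp /= !ler_expR.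
have HC : cont_rect (f \o @cexp R) s S 0 (2 * pi).
  move=> x t xs _.
  apply: continuous_comp; first exact/differentiable_continuous/differentiable_cexp.
  exact/fc/nz.
have := @goursat R (f \o @cexp R) s S 0 (2 * pi) (ln rho) sS twopi_gt0 HC.
have sS' := ltW sS.
rewrite /rect_int (_ : (fun x => _ - (f \o cexp) (x +i* 0)) = fun=> 0); last first.
  by apply/funext => x; rewrite /= cexp_2pi subrr.
rewrite cint_cst// mul0r subr0.
rewrite cintB; try by apply: (cont_rect_vert HC); rewrite ?lexx sS'.
move=> /(_ _)/eqP; rewrite mulf_eq0 => H.
have /H : forall x t, s <= x <= S -> 0 <= t <= 2 * pi -> x != ln rho ->
   differentiable (f \o @cexp R) (x +i* t).
  move=> x t xs _ xrho; apply: differentiable_comp; first exact: differentiable_cexp.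
  apply: fd; first exact: nz.
  by rewrite normc_cexp /=; apply: contra xrho => /eqP <-; rewrite expRK.
by rewrite eq_complex /= oner_eq0 andbF/= subr_eq0 => /eqP.
Qed.

Lemma circle_int_near_cst f s k (M : R) : cont_circle f s ->
  (forall z, normc z = expR s -> normc (f z - k) <= M) ->
  normc (circle_int f s - k * (2 * pi)%:C) <= 2 * M * (2 * pi).
Proof.
move=> cf fM.
have := @cint_near_cst R 0 (2 * pi) (fun t =>
  f (cexp (s +i* t))) k M (ltW twopi_gt0) (cont_circle_seg cf).
rewrite subr0; apply => x _; apply: fM; by rewrite normc_cexp.
Qed.

Lemma normc_arb_small z (K : R) : 0 < K ->
  (forall e : R, 0 < e -> normc z <= K * e) -> z = 0.
Proof.
move=> K0 H; apply/eqP; rewrite -normc_eq0; apply/eqP/le_anti.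
rewrite normc_ge0 andbT leNgt; apply/negP => z0.
have := H (normc z / (2 * K)) _; rewrite divr_gt0 ?mulr_gt0// => /(_ isT).
have -> : K * (normc z / (2 * K)) = normc z / 2 by field; rewrite gt_eqF.
by lra.
Qed.

(** The integral does not depend on the radius, and for a very small radius it
    is close to that of the constant [f 0]. *)
Lemma mean_value f S (rho : R) :
  (forall z, normc z <= expR S -> {for z, continuous f}) ->
  (forall z, normc z <= expR S -> normc z != rho -> differentiable f z) ->
  circle_int f S = f 0 * (2 * pi)%:C.
Proof.
move=> fc fd; apply/eqP; rewrite -subr_eq0; apply/eqP.
apply: (@normc_arb_small _ (2 * (2 * pi))); first by rewrite mulr_gt0// twopi_gt0.
move=> e e0.
have /continuous_normcP/(_ e e0)[d d0 fe] : {for 0, continuous f}.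
  by apply: fc; rewrite Normc.normc0 expR_ge0.
pose s := Num.min (S - 1) (ln (d / 2)).
have d20 : 0 < d / 2 by rewrite divr_gt0.
have sS : s < S by rewrite gt_min ltrBlDr ltrDl ltr01.
have sd : expR s < d.
  apply: (@le_lt_trans _ _ (d / 2)); last by rewrite ltr_pdivrMr// ltr_pMr ?ltr1n.
  by rewrite -[leRHS]lnK ?posrE// ler_expR ge_min lexx orbT.
rewrite -(@circle_int_const f s S rho)//.
- rewrite mulrAC; apply: circle_int_near_cst => z zs.
    by apply: fc; rewrite zs ler_expR ltW.
  by apply/ltW/fe; rewrite subr0 zs.
- by move=> z /andP[_ ?]; exact: fc.
- by move=> z /andP[_ ?]; exact: fd.
Qed.

Lemma differentiable_idC z : differentiable (fun u : R[i] => u) z.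
Proof. by have := is_diff_id z => -[]. Qed.

Lemma differentiable_kernel a z : z != a ->
  differentiable (fun u : R[i] => u / (u - a)) z.
Proof.
move=> za; apply: differentiableM; first exact: differentiable_idC.
apply: differentiableV; last by rewrite subr_eq0.
by apply: differentiableB; [exact: differentiable_idC|exact: differentiable_cst].
Qed.

(** Outside the disc of radius [normc a] the kernel is holomorphic, and it
    tends to 1 at infinity: the integral does not depend on the radius and its
    limit for large radii is 2 pi. *)
Lemma circle_int_kernel a S : normc a < expR S ->
  circle_int (fun z => z / (z - a)) S = (2 * pi)%:C.
Proof.
move=> aS; rewrite -[RHS]mul1r; apply/eqP; rewrite -subr_eq0; apply/eqP.
apply: (@normc_arb_small _ (2 * (2 * pi))); first by rewrite mulr_gt0// twopi_gt0.
move=> e e0.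
(* On the circle of radius exp T the kernel is within e of 1. *)
pose T := Num.max (S + 1) (ln (normc a + (normc a + 1) / e)).
have p0 : 0 < (normc a + 1) / e by rewrite divr_gt0// ltr_wpDl ?normc_ge0.
have ST : S < T by rewrite lt_max ltrDl ltr01.
have Td : normc a + (normc a + 1) / e <= expR T.
  by rewrite -[leLHS]lnK ?posrE ?ler_expR ?le_max ?lexx ?orbT// ltr_wpDl ?normc_ge0.
have za z : expR S <= normc z -> z != a.
  by move=> zS; apply: contraTneq zS => ->; rewrite -ltNge.
rewrite (@circle_int_const _ S T (- 1))//.
- rewrite mulrAC; apply: circle_int_near_cst => z zT.
    by apply/differentiable_continuous/differentiable_kernel/za;
      rewrite zT ler_expR ltW.
  have zna : z - a != 0 by rewrite subr_eq0 za// zT ler_expR ltW.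
  have -> : z / (z - a) - 1 = a / (z - a) by field.
  rewrite Normc.normcM Normc.normcV ler_pdivrMr ?normc_gt0//.
  apply: (@le_trans _ _ (e * (normc z - normc a))); last
    by rewrite ler_pM2l// lerB_normc.
  have : e * ((normc a + 1) / e) <= e * (normc z - normc a).
    by rewrite ler_pM2l// zT; lra.
  by rewrite mulrC divfK ?gt_eqF//; lra.
- by move=> z /andP[? _]; exact/differentiable_continuous/differentiable_kernel/za.
- by move=> z /andP[? _] _; exact/differentiable_kernel/za.
Qed.

Lemma eq_circle_int f g s : (forall z, normc z = expR s -> f z = g z) ->
  circle_int f s = circle_int g s.
Proof. by move=> fg; apply: eq_cint => t _; apply: fg; rewrite normc_cexp. Qed.

Lemma circle_intD f g s : cont_circle f s -> cont_circle g s ->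
  circle_int (fun z => f z + g z) s = circle_int f s + circle_int g s.
Proof. by move=> cf cg; rewrite /circle_int cintD//; exact: cont_circle_seg. Qed.

Lemma circle_intZ k f s : cont_circle f s -> circle_int (fun z => k * f z) s =
  k * circle_int f s.
Proof. by move=> cf; rewrite /circle_int cintZ//; exact: cont_circle_seg. Qed.

(** The mean value property is applied to [z] times the difference quotient of
    [g] at [a], which vanishes at 0; its singularity at [a] lies on an
    exceptional circle. *)
Lemma cauchy_formula g S a :
  (forall z, normc z <= expR S -> differentiable g z) -> normc a < expR S ->
  circle_int (fun z => z / (z - a) * g z) S = (2 * pi)%:C * g a.
Proof.
move=> gd aS.
have /differentiable_normcP[B HB] := gd _ (ltW aS).
(* Without its linear part the difference quotient tends to 0 at a, which is
   also its value there since 0 / 0 = 0; so r is continuous at a. *)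
pose r z := (g z - g a - B * (z - a)) / (z - a).
have rd z : normc z <= expR S -> z != a -> differentiable r z.
  move=> zS za; apply: differentiableM.
    apply: differentiableB.
      by apply: differentiableB; [exact: gd|exact: differentiable_cst].
    apply: differentiableM; first exact: differentiable_cst.
    by apply: differentiableB; [exact: differentiable_idC|exact: differentiable_cst].
  apply: differentiableV; last by rewrite subr_eq0.
  by apply: differentiableB; [exact: differentiable_idC|exact: differentiable_cst].
have ra : {for a, continuous r}.
  apply/continuous_normcP => e e0.
  have [d d0 H] := HB _ (divr_gt0 e0 (ltr0Sn _ 1)).
  exists d => // u /H le; rewrite /r !subrr !mulr0 !subr0 mul0r subr0.
  have [->|ua] := eqVneq u a; first by rewrite !subrr mulr0 subr0 mul0r Normc.normc0.
  rewrite Normc.normcM Normc.normcV ltr_pdivrMr ?normc_gt0 ?subr_eq0//.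
  apply: le_lt_trans le _; rewrite ltr_pM2r ?normc_gt0 ?subr_eq0//.
  by rewrite ltr_pdivrMr// ltr_pMr ?ltr1n.
have rc z : normc z <= expR S -> {for z, continuous r}.
  have [->//|za zS] := eqVneq z a.
  exact/differentiable_continuous/rd.
have m1 : circle_int (fun z => z * r z) S = 0.
  have -> : 0 = (0 * r 0) * (2 * pi)%:C :> R[i] by rewrite !mul0r.
  apply: (@mean_value (fun z => z * r z) S (normc a)).
    by move=> z zS; apply: cont_mul; [exact: cont_id|exact: rc].
  move=> z zS za; apply: differentiableM; first exact: differentiable_idC.
  by apply: rd => //; apply: contraNneq za => ->.
have m2 : circle_int (fun z => z) S = 0.
  rewrite -(mul0r (2 * pi)%:C); apply: (@mean_value (fun z => z) S 0) => z _.
    exact: cont_id.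
  by move=> _; exact: differentiable_idC.
have zna z : normc z = expR S -> z != a.
  by move=> zS; apply: contraTneq aS => <-; rewrite zS ltxx.
have c1 : cont_circle (fun z : R[i] => z) S by move=> z _; exact: cont_id.
have c2 : cont_circle (fun z => z / (z - a)) S.
  by move=> z /zna za; exact/differentiable_continuous/differentiable_kernel.
have c3 : cont_circle (fun z => z * r z) S.
  by move=> z zS; apply: cont_mul; [exact: cont_id|apply: rc; rewrite zS].
have cz k f : cont_circle f S -> cont_circle (fun z => k * f z) S.
  by move=> cf z zS; apply: cont_mul; [exact: cont_cst|exact: cf].
transitivity (circle_int (fun z => z * r z + (B * z + g a * (z / (z - a)))) S).
  apply: eq_circle_int => z /zna za; rewrite /r; field.
  by rewrite subr_eq0.
have c4 := cz B _ c1; have c5 := cz (g a) _ c2.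
have c45 : cont_circle (fun z => B * z + g a * (z / (z - a))) S.
  by move=> z zS; apply: cont_add; [exact: c4|exact: c5].
rewrite (circle_intD c3 c45) (circle_intD c4 c5) (circle_intZ B c1) (circle_intZ (g
  a) c2).
by rewrite m1 m2 circle_int_kernel// mulr0 !add0r mulrC.
Qed.

End Circle.

(** * Hermite's error formula for Lagrange interpolation *)

Section Hermite.
Context {K : fieldType}.
Implicit Types (x : nat -> K) (z t : K).

Definition nodal x M : {poly K} := \prod_(i < M) ('X - (x i)%:P).

Lemma nodalE x M t : (nodal x M).[t] = \prod_(i < M) (t - x i).
Proof. by rewrite /nodal horner_prod; apply: eq_bigr => i _; rewrite hornerXsubC. Qed.

(** The quotient of [w - w.[z]] by ['X - z], where [w] is the nodal
    polynomial, has degree less than [M], hence equals its own Lagrange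
    interpolant; its values at the nodes are known because [w] vanishes
    there. *)
Lemma hermite_remainder x M z t : (0 < M)%N -> injective x ->
  (forall i, z != x i) -> z != t ->
  (z - t)^-1 - \sum_(i < M) (tnth (lagrange M x) i : {poly K}).[t] * (z - x i)^-1 =
  (nodal x M).[t] / (nodal x M).[z] * (z - t)^-1.
Proof.
move=> M0 xi zx zt.
pose w := nodal x M.
have [q qE] : exists q, w - w.[z]%:P = q * ('X - z%:P).
  by apply/factor_theorem; rewrite rootE !hornerE subrr.
have qh y : q.[y] * (y - z) = w.[y] - w.[z].
  by have := congr1 (horner^~ y) qE; rewrite !hornerE => <-.
have wz : w.[z] != 0.
  by rewrite /w nodalE; apply/prodf_neq0 => i _; rewrite subr_eq0.
have sq : (size q <= M)%N.
  have [->|q0] := eqVneq q 0; first by rewrite size_poly0.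
  have sw : (size (w - w.[z]%:P)%R <= M.+1)%N.
    rewrite (leq_trans (size_polyD _ _))// geq_max size_polyN.
    rewrite /w /nodal size_prod_XsubC /index_enum -enumT size_enum_ord leqnn/=.
    by rewrite (leq_trans (size_polyC_leq1 _)).
  by move: sw; rewrite qE size_Mmonic ?monicXsubC// size_XsubC addn2.
have qx y : z != y -> q.[y] = (w.[z] - w.[y]) * (z - y)^-1.
  move=> zy; have zy0 : z - y != 0 by rewrite subr_eq0.
  by apply: (mulIf zy0); rewrite divfK// -[z - y]opprB mulrN qh opprB.
have wx (i : 'I_M) : w.[x i] = 0.
  by rewrite /w nodalE (bigD1 i)//= subrr mul0r.
have := congr1 (horner^~ t) (lagrange_gen M0 xi sq).
rewrite horner_sum /= qx// => E.
have {}E : (w.[z] - w.[t]) * (z - t)^-1 =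
    w.[z] * \sum_(i < M) (tnth (lagrange M x) i : {poly K}).[t] * (z - x i)^-1.
  rewrite E mulr_sumr; apply: eq_bigr => i _.
  by rewrite hornerM hornerC qx// wx subr0 -mulrA; congr (_ * _); rewrite mulrC.
apply: (mulfI wz); rewrite mulrBr -/w -E mulrBl opprB addrC subrK.
by rewrite mulrA mulrCA mulfV// mulr1.
Qed.

End Hermite.

Section Interpolation.
Context {R : realType}.
Implicit Types (g : R[i] -> R[i]) (S B : R) (x : nat -> R[i]).

Lemma normc_nodal_small x M t (r : R) : normc t <= r ->
  (forall i, normc (x i) <= r) -> normc (nodal x M).[t] <= (2 * r) ^+ M.
Proof.
move=> tr xr; rewrite nodalE normc_prod.
rewrite -[leRHS](_ : \prod_(i < M) (2 * r) = _); last by rewrite prodr_const card_ord.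
apply: ler_prod => i _; rewrite normc_ge0/=.
apply: le_trans (ler_normcB _ _) _; rewrite mulr_natl mulr2n; exact: lerD.
Qed.

Lemma normc_nodal_large x M z (r : R) : 0 <= r -> 4 * r <= normc z ->
  (forall i, normc (x i) <= r) -> (3 * r) ^+ M <= normc (nodal x M).[z].
Proof.
move=> r0 zr xr; rewrite nodalE normc_prod.
rewrite -[leLHS](_ : \prod_(i < M) (3 * r) = _); last by rewrite prodr_const card_ord.
apply: ler_prod => i _; rewrite mulr_ge0//=.
by apply: le_trans (lerB_normc _ _); have := xr i; lra.
Qed.

Lemma circle_int_sum (n : nat) (F : 'I_n -> R[i] -> R[i]) S :
  (forall i, cont_circle (F i) S) ->
  cont_circle (fun z => \sum_(i < n) F i z) S /\
  circle_int (fun z => \sum_(i < n) F i z) S = \sum_(i < n) circle_int (F i) S.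
Proof.
elim: n F => [|n IH] F Fc.
  have -> : (fun z => \sum_(i < 0) F i z) = fun=> 0.
    by apply/funext => z; rewrite big_ord0.
  split; first by move=> z _; exact: cont_cst.
  rewrite big_ord0 /circle_int.
  by rewrite cint_cst ?mul0r// ltW// twopi_gt0.
have [c1 e1] := IH (fun i => F (lift ord0 i)) (fun i => Fc _).
have E : (fun z => \sum_(i < n.+1) F i z) = fun z => F ord0 z + \sum_(i <
  n) F (lift ord0 i) z.
  by apply/funext => z; rewrite big_ord_recl.
rewrite E; split; first by move=> z zS; apply: cont_add; [exact: Fc|exact: c1].
by rewrite (circle_intD (Fc _) c1) e1 big_ord_recl.
Qed.

(** By Cauchy's formula and [hermite_remainder] the error is the mean over the
    circle of [g z * (z / (z - t))] times [w.[t] / w.[z]], with [w] the nodal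
    polynomial. As [t] and the nodes are four times closer to 0 than the
    circle, each of the [M] factors of the last ratio is at most (1/4 + 1/4) /
    (1 - 1/4) = 2/3. *)
Lemma interpolation_error g S B x M t : (0 < M)%N -> injective x ->
  (forall z, normc z <= expR S -> differentiable g z) ->
  (forall z, normc z = expR S -> normc (g z) <= B) ->
  (forall i, 4 * normc (x i) <= expR S) -> 4 * normc t <= expR S ->
  normc (g t - \sum_(i < M) (tnth (lagrange M x) i : {poly _}).[t] * g (x i)) <=
    (8 / 3) * B * (2 / 3) ^+ M.
Proof.
move=> M0 xi gd gB xS tS.
have rho0 : 0 < expR S by exact: expR_gt0.
have small a : 4 * normc a <= expR S -> normc a < expR S by lra.
have ne a z : 4 * normc a <= expR S -> normc z = expR S -> z != a.
  by move=> /small aS zS; apply: contraTneq aS => <-; rewrite zS ltxx.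
have cg a : 4 * normc a <= expR S -> cont_circle (fun z => z / (z - a) * g z) S.
  move=> aS z zS; apply: differentiable_continuous.
  by apply: differentiableM; [exact/differentiable_kernel/ne|apply: gd; rewrite zS].
pose l i := (tnth (lagrange M x) i : {poly R[i]}).[t] : R[i].
pose F (i : 'I_M) z := - l i * (z / (z - x i) * g z).
have Fc i : cont_circle (F i) S.
  by move=> z zS; apply: cont_mul; [exact: cont_cst|exact: cg].
have [sc se] := circle_int_sum Fc.
pose G z := z / (z - t) * g z + \sum_(i < M) F i z.
have Gc : cont_circle G S by move=> z zS; apply: cont_add; [exact: cg|exact: sc].
have GE : circle_int G S = (2 * pi)%:C * (g t - \sum_(i < M) l i * g (x i)).
  rewrite (circle_intD (cg _ tS) sc).
  rewrite cauchy_formula ?small// se mulrBr mulr_sumr -sumrN; congr (_ + _).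
  apply: eq_bigr => i _; rewrite (circle_intZ (- l i) (cg _ (xS i))).
  by rewrite cauchy_formula ?small// mulNr mulrCA.
have Gb z : normc z = expR S -> normc (G z - 0) <= 4 / 3 * B * (2 / 3) ^+ M.
  move=> zS; rewrite subr0.
  have -> : G z = (nodal x M).[t] / (nodal x M).[z] * (z / (z - t) * g z).
    have -> : G z = z * g z * ((z - t)^-1 - \sum_(i < M) l i * (z - x i)^-1).
      rewrite /G mulrBr mulr_sumr -sumrN; congr (_ + _); first by rewrite mulrAC.
      by apply: eq_bigr => i _; rewrite /F; ring.
    rewrite hermite_remainder//; [by ring|by move=> i; exact: ne|exact: ne].
  pose r := expR S / 4.
  have r0 : 0 < r by rewrite divr_gt0.
  have tr : normc t <= r by rewrite ler_pdivlMr// mulrC.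
  have xr i : normc (x i) <= r by rewrite ler_pdivlMr// mulrC.
  have N1 := normc_nodal_small M tr xr.
  have rz : 4 * r <= normc z by rewrite zS /r; lra.
  have N2 := normc_nodal_large M (ltW r0) rz xr.
  rewrite !Normc.normcM !Normc.normcV.
  have n3 : 0 < (3 * r) ^+ M by rewrite exprn_gt0// mulr_gt0.
  have A1 : normc (nodal x M).[t] / normc (nodal x M).[z] <= (2 / 3) ^+ M.
    have -> : 2 / 3 = (2 * r) / (3 * r) by field; rewrite gt_eqF.
    rewrite expr_div_n ler_pM ?invr_ge0 ?normc_ge0//.
    by rewrite lef_pV2 ?posrE// (lt_le_trans n3).
  have A2 : normc z / normc (z - t) <= 4 / 3.
    have zt : 3 * r <= normc (z - t).
      by apply: le_trans (lerB_normc _ _); lra.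
    rewrite ler_pdivrMr; last by apply: lt_le_trans zt; rewrite mulr_gt0.
    by rewrite zS (_ : expR S = 4 * r); [lra|rewrite /r; lra].
  rewrite [leRHS]mulrC ler_pM ?mulr_ge0 ?invr_ge0 ?normc_ge0//.
  by rewrite ler_pM ?mulr_ge0 ?invr_ge0 ?normc_ge0 ?gB.
have := circle_int_near_cst Gc Gb; rewrite mul0r subr0 GE Normc.normcM normc_real.
rewrite gtr0_norm ?twopi_gt0// (mulrC (2 * pi)) ler_pM2r ?twopi_gt0//.
by move=> /le_trans; apply; rewrite le_eqVlt; apply/orP; left; apply/eqP; ring.
Qed.

End Interpolation.

(** * Boundedness of the functions of the Banach space *)

Section Domains.
Context {R : realType}.
Implicit Types (p d : nat) (r : R).

Lemma ccos_real (a : R) : ccos (a +i* 0) = (cos a)%:C.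
Proof.
rewrite /ccos.
have -> : (0 +i* 1) * (a +i* 0) = 0 +i* a.
  by apply/eqP; rewrite eq_complex /=; apply/andP; split; apply/eqP; ring.
rewrite -[- (0 +i* a)]/((- 0) +i* (- a)) oppr0 /cexp /= expR0 cosN sinN.
rewrite !mul1r.
have -> : cos a +i* sin a + cos a -i* sin a = (cos a)%:C * 2.
  by apply/eqP; rewrite eq_complex /=; apply/andP; split; apply/eqP; ring.
by rewrite mulfK// pnatr_eq0.
Qed.

Lemma normc_ccos (x y : R) : normc (ccos (x +i* y)) <= expR `|y|.
Proof.
rewrite /ccos Normc.normcM Normc.normcV.
have -> : normc 2 = 2 :> R
  by rewrite -[2 : R[i]]/(2%:R) -(rmorph_nat (@real_complex R)) normc_real ger0_norm.
rewrite ler_pdivrMr//; apply: le_trans (ler_normcD _ _) _.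
rewrite !normc_cexp /= !mul0r !mul1r sub0r opprK mulrC mulr_natl mulr2n lerD// ler_expR.
  by rewrite ler_normr lexx orbT.
by rewrite ler_norm.
Qed.

Lemma pnorm_ge p d (y : 'rV[R]_d) j : (0 < p)%N -> `|y 0 j| <= pnorm p y.
Proof.
move=> p0.
have -> : `|y 0 j| = (`|y 0 j| ^+ p) `^ p%:R^-1.
  by rewrite -powR_mulrn// -powRrM mulfV ?powRr1// pnatr_eq0 -lt0n.
rewrite /pnorm; apply: ge0_ler_powR.
- by rewrite invr_ge0 ler0n.
- by rewrite nnegrE exprn_ge0.
- by rewrite nnegrE sumr_ge0// => i _; rewrite exprn_ge0.
rewrite (bigD1 j)//= lerDl sumr_ge0// => i _; exact: exprn_ge0.
Qed.

Lemma cube_sub_Edom p d r (x : 'rV[R[i]]_d) : (0 < p)%N -> 0 < r ->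
  cube x -> Edom p r x.
Proof.
move=> p0 r0 [a a1 ->]; exists (\row_j acos (a 0 j)), 0; split.
  rewrite /pball /= /pnorm big1 ?powR0 ?invr_eq0 ?pnatr_eq0 -?lt0n//.
  by move=> j _; rewrite mxE normr0 expr0n gtn_eqF.
by apply/rowP => j; rewrite !mxE ccos_real acosK// in_itv/=.
Qed.

Lemma Edom_bounded p d r (z : 'rV[R[i]]_d) j : (0 < p)%N ->
  Edom p r z -> normc (z 0 j) <= expR r.
Proof.
move=> p0 [x [y [yr ->]]]; rewrite mxE; apply: le_trans (normc_ccos _ _) _.
by rewrite ler_expR (le_trans (pnorm_ge _ _ p0))// ltW.
Qed.

Definition csquare (C : R) : set R[i] :=
  [set u | - C <= complex.Re u <= C /\ - C <= complex.Im u <= C].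

Lemma compact_csquare C : compact (csquare C).
Proof.
have -> : csquare C = (fun q : R * R => q.1 +i* q.2) @` (`[- C, C] `*` `[- C, C]).
  apply/seteqP; split.
    by move=> [a b] /= [h1 h2]; exists (a, b) => //; split; rewrite /= in_itv.
  by move=> _ [[a b] [/= + +] <-]; rewrite !in_itv.
apply: continuous_compact; last by apply: compact_setX; exact: segment_compact.
apply: continuous_subspaceT => -[a b] A /nbhs_normcP[e e0 sub].
have e20 : 0 < e / 2 by rewrite divr_gt0.
apply/nbhs_ballP; exists (e / 2) => // -[a' b'] [/= ha hb]; apply: sub.
apply: le_lt_trans (normc_le_ReIm _) _; rewrite /=.
move: ha hb; rewrite /ball/= -normrN opprB -[`|b - b'|]normrN opprB; lra.
Qed.

(** In finite dimension it suffices to bound the coordinates: the cosine of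
    [x + iy] has modulus at most [exp |y|], and the p-norm dominates each
    [|y_j|]. *)
Lemma compact_closure_Edom p d r : (0 < p)%N ->
  compact (closure (Edom p r : set 'rV[R[i]]_d)).
Proof.
move=> p0.
pose box : set 'rV[R[i]]_d := [set z | forall j, csquare (expR r) (z ord0 j)].
have cbox : compact box by apply: (@rV_compact _ d (fun=> csquare (expR r))) => _;
  exact: compact_csquare.
apply: (subclosed_compact _ cbox); first exact: closed_closure.
have /closure_id -> : closed box by apply: compact_closed cbox; exact: norm_hausdorff.
apply: closureS => z Ez j.
have zb := Edom_bounded j p0 Ez.
by rewrite /csquare /= -!ler_norml; split; apply: le_trans zb;
  [exact: Re_le_normc|exact: Im_le_normc].
Qed.

(** A supremum in [R] is an upper bound only for bounded sets; here
    boundedness comes from the continuity of [phi] on the compact closure of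
    the domain. *)
Lemma le_Hnorm p d r (phi : 'rV[R[i]]_d -> R[i]) z : (0 < p)%N ->
  Hspace p r phi -> Edom p r z -> normc (phi z) <= Hnorm p r phi.
Proof.
move=> p0 [_ phic _] Ez.
have cN : continuous (fun u : R[i] => normc u : R).
  move=> u A /nbhs_ballP[e /= e0 sub]; apply/nbhs_normcP; exists e => // u' uu.
  apply: sub; rewrite /ball/=; apply: le_lt_trans uu.
  have h1 := lerB_normc u u'; have h2 := lerB_normc u' u; rewrite normc_distC in h1.
  by rewrite ler_norml; lra.
have : compact ((fun z => normc (phi z) : R) @` closure (Edom p r)).
  apply: continuous_compact; last exact: compact_closure_Edom.
  move=> x; apply: continuous_comp; [exact: phic|exact: cN].
move=> /compact_bounded[M [_ HM]].
apply: ub_le_sup; last by exists z.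
exists (M + 1) => _ [u Eu <-].
have /HM : M < M + 1 by rewrite ltrDl.
move=> /(_ (normc (phi u))); rewrite /= ger0_norm ?normc_ge0//; apply.
by exists u => //; exact: subset_closure.
Qed.

End Domains.

(** * Absolutely convergent series and weighted interpolation *)

Section ComplexSeries.
Context {R : realType}.
Implicit Types (u : nat -> R[i]) (l : R[i]).

Lemma cvgn_normcP u l : u @ \oo --> l <->
  forall e : R, 0 < e -> exists N, forall n, (N <= n)%N -> normc (u n - l) < e.
Proof.
split.
  move=> /cvgrPdist_lt H e e0; have := H e%:C; rewrite ltcR => /(_ e0)[N _ HN].
  by exists N => n Nn; have := HN n Nn; rewrite /= ltcR normc_distC.
move=> H; apply/cvgrPdist_lt => _ /posc_real[e e0 ->].
have [N HN] := H e e0; exists N => // n Nn /=.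
by rewrite ltcR normc_distC; exact: HN.
Qed.

Lemma le_normc_lim u l (K : R) : u @ \oo --> l ->
  (forall n, normc (u n) <= K) -> normc l <= K.
Proof.
move=> /cvgn_normcP ul uK; rewrite leNgt; apply/negP => lK.
have [|N HN] := ul (normc l - K); first by rewrite subr_gt0.
have := HN N (leqnn _); rewrite normc_distC => /(le_lt_trans (lerB_normc _ _)).
by have := uK N; lra.
Qed.

Lemma cvgn_abs_series u (K : R) :
  (forall n, \sum_(0 <= k < n) normc (u k) <= K) -> cvgn (series u).
Proof.
move=> uK.
have cN : cvgn (series (fun n => normc (u n) : R)).
  apply: nondecreasing_is_cvgn; last by exists K => _ [n _ <-]; exact: uK.
  by apply: nondecreasing_series => n _ _; exact: normc_ge0.
have cr (f : R[i] -> R) : (forall z, `|f z| <= normc z) ->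
    cvgn (series (fun n => f (u n))).
  move=> fn; apply: (@normed_cvg _ R^o).
  by apply: series_le_cvg cN => n //=; exact: normc_ge0.
have /cvg_ex[/= a /cvgrPdist_lt ua] := cr _ Re_le_normc.
have /cvg_ex[/= b /cvgrPdist_lt ub] := cr _ Im_le_normc.
apply/cvg_ex; exists (a +i* b); apply/cvgn_normcP => e e0.
have e20 : 0 < e / 2 by rewrite divr_gt0.
have [N1 _ H1] := ua _ e20; have [N2 _ H2] := ub _ e20.
exists (maxn N1 N2) => n; rewrite geq_max => /andP[/H1/= h1 /H2/= h2].
rewrite normc_distC; apply: le_lt_trans (normc_le_ReIm _) _.
have E : series u n = series (fun n => complex.Re (u n)) n +i* series (fun n =>
  complex.Im (u n)) n.
  rewrite /series/=; elim: n {h1 h2} => [|n IH]; first by rewrite !big_geq.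
  by rewrite !big_nat_recr//= IH; case: (u n).
by rewrite E /=; lra.
Qed.

End ComplexSeries.

Section TransferError.
Context {R : realType}.

(** Replacing each [g n] by a combination of the finitely many values [gq q]
    costs [eta] per unit of weight. For partial sums this is the triangle
    inequality after exchanging two finite sums; the estimate then passes to
    the limit. *)
Lemma weighted_interpolation_error (Q : nat) (w g : nat -> R[i])
    (gq : 'I_Q -> R[i]) (L : nat -> 'I_Q -> R[i]) (K : 'I_Q -> R) (W eta B : R) :
  (forall n, \sum_(0 <= k < n) normc (w k) <= W) ->
  (forall n q, normc (L n q) <= K q) ->
  (forall n, normc (g n) <= B) ->
  (forall n, normc (g n - \sum_(q < Q) L n q * gq q) <= eta) ->
  normc (limn (series (fun n => w n * g n)) -
    \sum_(q < Q) limn (series (fun n => w n * L n q)) * gq q) <= W * eta.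
Proof.
move=> wW LK gB err.
have eta0 : 0 <= eta by exact: le_trans (normc_ge0 _) (err 0%N).
have cW (f : nat -> R[i]) (M : R) : (forall n, normc (f n) <= M) ->
    cvgn (series (fun n => w n * f n)).
  move=> fM; have M0 : 0 <= M := le_trans (normc_ge0 _) (fM 0%N).
  apply: (@cvgn_abs_series _ _ (W * M)) => n.
  apply: le_trans (ler_wpM2r M0 (wW n)); rewrite mulr_suml.
  by apply: ler_sum => k _; rewrite Normc.normcM ler_wpM2l ?normc_ge0.
have cg := cW g B gB.
have cL q := cW (fun n => L n q) (K q) (fun n => LK n q).
pose T n := series (fun n => w n * g n) n - \sum_(q < Q) series (fun n =>
  w n * L n q) n * gq q.
apply: (@le_normc_lim _ T) => [|n].
  apply: cvgB; first exact: cg.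
  apply: cvg_big => [|q _]; first by move=> ?; exact: add_continuous.
  by apply: cvgMl; exact: cL.
have -> : T n = \sum_(0 <= k < n) w k * (g k - \sum_(q < Q) L k q * gq q).
  rewrite /T /series /=.
  under [in RHS]eq_bigr do rewrite mulrBr mulr_sumr.
  rewrite sumrB exchange_big /=; congr (_ - _); apply: eq_bigr => q _.
  by rewrite mulr_suml; apply: eq_bigr => k _; rewrite mulrA.
apply: le_trans (normc_sum _ _) _.
apply: le_trans (ler_wpM2r eta0 (wW n)); rewrite mulr_suml.
by apply: ler_sum => k _; rewrite Normc.normcM ler_wpM2l ?normc_ge0.
Qed.

End TransferError.

Section Weights.
Context {R : realType}.

Definition node (N i : nat) : R[i] := ((N + i)%:R)^-1.

Lemma node_inj N : (0 < N)%N -> injective (node N).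
Proof.
move=> N0 i j /invr_inj/eqP; rewrite eqr_nat eqn_add2l => /eqP//.
Qed.

Lemma normc_natV n : normc (n%:R^-1 : R[i]) = n%:R^-1.
Proof.
by rewrite Normc.normcV -(rmorph_nat (@real_complex R)) normc_real ger0_norm.
Qed.

(** Coefficient of the value with index [q] in the reconstruction of the value
    with index [n]. The indices below [N] are reproduced exactly; from [N] on,
    the value at [n] is interpolated in the variable [1 / n] from the [M]
    nodes [1 / (N + j)]. *)
Definition index_weight (N M n : nat) (q : 'I_(N + M)) : R[i] :=
  match fintype.split q with
  | inl i => (n == i)%:R
  | inr j => if (n < N)%N then 0 else
             (tnth (lagrange M (node N)) j : {poly R[i]}).[n%:R^-1]
  end.

Lemma split_lshift (m n : nat) (i : 'I_m) : fintype.split (lshift n i) = inl i.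
Proof. exact: (unsplitK (inl i)). Qed.

Lemma split_rshift (m n : nat) (i : 'I_n) : fintype.split (rshift m i) = inr i.
Proof. exact: (unsplitK (inr i)). Qed.

(** For a fixed node the coefficients stay bounded in [n] since the points
    [1 / n] lie in the unit disc; this is what makes the weights of the final
    formula convergent series. *)
Lemma index_weight_bounded N M (q : 'I_(N + M)) : (0 < N)%N ->
  exists K : R, forall n, normc (index_weight n q) <= K.
Proof.
move=> N0; rewrite /index_weight; case: fintype.split => [i|j].
  by exists 1 => n; case: eqP => _; rewrite ?Normc.normc1// Normc.normc0.
have poly_bounded (p : {poly R[i]}) : exists K : R, forall n,
    normc (if (n < N)%N then 0 else p.[n%:R^-1]) <= K.
  exists (\sum_(i < size p) normc p`_i) => n; case: ltnP => [_|Nn].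
    by rewrite Normc.normc0 sumr_ge0// => i _; exact: normc_ge0.
  rewrite horner_coef; apply: le_trans (normc_sum _ _) _; apply: ler_sum => i _.
  rewrite Normc.normcM ler_piMr ?normc_ge0// normcX normc_natV exprn_ile1 ?invr_ge0//.
  by rewrite invf_le1 ?ltr0n ?ler1n; apply: leq_trans Nn.
exact: poly_bounded.
Qed.

(** The hypothesis on [N] puts the nodes and the points [1 / n] in the disc of
    radius [rho / 4] required by [interpolation_error]. Only the values of
    [gs] from [N] on need to come from a holomorphic function. *)
Lemma index_weight_error (g : R[i] -> R[i]) (gs : nat -> R[i]) (rho B : R) N M n :
  (0 < M)%N -> 0 < rho -> 4 <= rho * N%:R -> 0 <= B ->
  (forall z, normc z <= rho -> differentiable g z) ->
  (forall z, normc z = rho -> normc (g z) <= B) ->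
  (forall k, (N <= k)%N -> gs k = g k%:R^-1) ->
  normc (gs n - \sum_(q < N + M) index_weight n q * gs q) <=
    8 / 3 * B * (2 / 3) ^+ M.
Proof.
move=> M0 rho0 rN B0 gd gB gsE.
have N0 : (0 < N)%N by rewrite lt0n; apply: contraTneq rN => ->; rewrite mulr0 -ltNge.
have lS : expR (ln rho) = rho by rewrite lnK.
have small k : (N <= k)%N -> 4 * normc (k%:R^-1 : R[i]) <= expR (ln rho).
  move=> Nk; rewrite lS normc_natV ler_pdivrMr ?ltr0n; last exact: leq_trans Nk.
  by apply: le_trans rN _; rewrite ler_pM2l// ler_nat.
rewrite big_split_ord /=; have [nN|Nn] := ltnP n N.
  rewrite (bigD1 (Ordinal nN))//= big1 ?addr0; last first.
    by move=> i /eqP ni; rewrite /index_weight split_lshift; case: eqP => [nE|_];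
      rewrite ?mul0r//; case: ni; apply: val_inj.
  rewrite big1 ?addr0; last by move=> i _; rewrite /index_weight split_rshift nN mul0r.
  rewrite /index_weight split_lshift /= eqxx mul1r subrr Normc.normc0.
  by rewrite mulr_ge0 ?mulr_ge0 ?exprn_ge0 ?divr_ge0.
rewrite big1 ?add0r; last first.
  move=> i _; rewrite /index_weight split_lshift; case: eqP => [nE|_]; last
    by rewrite mul0r.
  by move: Nn; rewrite nE leqNgt ltn_ord.
have -> : \sum_(i < M) index_weight n (rshift N i) * gs (N + i)%N =
    \sum_(i < M) (tnth (lagrange M (node N)) i : {poly R[i]}).[n%:R^-1] * g (node N i).
  apply: eq_bigr => i _; rewrite /index_weight split_rshift ltnNge Nn/=.
  by rewrite gsE ?leq_addr.
rewrite gsE//; apply: (@interpolation_error _ g (ln rho)) => //; rewrite ?lS//.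
- exact: node_inj.
- by move=> i; rewrite -lS; exact/small/leq_addr.
- by rewrite -lS; exact: small.
Qed.

End Weights.

(** * Number of interpolation nodes for a prescribed error *)

Section NodeCount.
Context {R : realType}.

(** A number of factors 2 / 3 that brings [D] below [e]: a positive integer
    above log (D / e) / log (3 / 2). *)
Definition node_count (D e : R) : nat := (Num.truncn (ln (D / e) / ln (3 / 2))).+1.

Lemma ln32_gt0 : 0 < ln (3 / 2) :> R.
Proof. by rewrite ln_gt0//; lra. Qed.

Lemma node_countP (D e : R) : 0 < D -> 0 < e ->
  D * (2 / 3) ^+ node_count D e <= e.
Proof.
move=> D0 e0; set M := node_count D e.
have MD : ln (D / e) <= M%:R * ln (3 / 2).
  by rewrite -ler_pdivrMr ?ln32_gt0// ltW// truncnS_gt.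
have De0 : 0 < D / e by rewrite divr_gt0.
have q0 : 0 < 3 / 2 :> R by rewrite divr_gt0.
have : D / e <= (3 / 2) ^+ M.
  rewrite -ler_ln ?posrE ?exprn_gt0// lnXn// -[leRHS]mulr_natl.
  exact: MD.
rewrite ler_pdivrMr// => DM.
have -> : 2 / 3 = (3 / 2)^-1 :> R by rewrite invf_div.
by rewrite exprVn ler_pdivrMr ?exprn_gt0// mulrC.
Qed.

Lemma node_count_bigO (D : R) (N : nat) : 0 < D ->
  (fun e : R => (N + node_count D e)%:R : R) =O_ (0^'+) (fun e : R => ln e^-1).
Proof.
move=> D0; apply/eqOP.
pose C := (N.+1%:R + (`|ln D| + 1) / ln (3 / 2)) : R.
near=> k.
have kC : C <= k by near: k; apply: nbhs_pinfty_ge; exact: num_real.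
near=> e.
have e0 : 0 < e by near: e; exact: nbhs_right_gt.
have e1 : e < expR (-1) by near: e; apply: nbhs_right_lt; exact: expR_gt0.
have le1 : 1 <= ln e^-1.
  rewrite lnV ?posrE// lerNr -[leRHS]expRK ler_ln ?posrE ?expR_gt0//; exact: ltW.
rewrite [leLHS]ger0_norm// ger0_norm ?(le_trans ler01)//.
apply: (@le_trans _ _ (C * ln e^-1)); last by rewrite ler_wpM2r// (le_trans ler01).
rewrite /node_count addnS -addSn natrD.
have tr : (Num.truncn (ln (D / e) / ln (3 / 2)))%:R <=
  (`|ln D| + 1) / ln (3 / 2) * ln e^-1.
  apply: (@le_trans _ _ `|ln (D / e) / ln (3 / 2)|).
    have [x0|x0] := leP 0 (ln (D / e) / ln (3 / 2)).
      by rewrite (le_trans _ (ler_norm _))// truncn_le.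
    have -> : Num.truncn (ln (D / e) / ln (3 / 2)) = 0%N.
      by apply/truncn0Pn; rewrite -ltNge; lra.
    exact: normr_ge0.
  rewrite normrM [`|(ln (3 / 2))^-1|]gtr0_norm ?invr_gt0 ?ln32_gt0//.
  rewrite mulrAC ler_pM2r ?invr_gt0 ?ln32_gt0//.
  rewrite lnM ?posrE ?invr_gt0//; apply: le_trans (ler_normD _ _) _.
  rewrite (ger0_norm (le_trans ler01 le1)) mulrDl mul1r lerD2r.
  by rewrite ler_peMr.
by rewrite /C [leRHS]mulrDl lerD// ler_peMr.
Unshelve. all: by end_near. Qed.

End NodeCount.

(** * The chart at infinity and the theorem *)

Section Sphere.
Context {R : realType}.

Lemma near_neq0 (z : R[i]) : z != 0 -> \forall u \near z, u != 0.
Proof.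
move=> z0; apply/nbhs_normcP; exists (normc z); first by rewrite normc_gt0.
by move=> u; apply: contraTneq => ->; rewrite sub0r normcN ltxx.
Qed.

(** The chart [sphere_inv] is given by cases at 0, so away from 0
    differentiability is transported along the local equality with
    [z |-> z^-1]. *)
Lemma differentiable_sphere_chart (U : normedModType R[i]) (f : sphere R -> U) (z :
  R[i]) :
  sphere_analytic_at f (sphere_inv z) -> differentiable (f \o @sphere_inv R) z.
Proof.
rewrite /sphere_inv; have [->|z0] := eqVneq z 0; first by move=> /nbhs_singleton.
move=> /nbhs_singleton fd.
apply/derivable1_diffP.
apply: (@near_eq_derivable _ _ _ (fun u : R[i] => f (Some u^-1))).
  near=> u; rewrite /= /sphere_inv ifN//.
  by near: u; exact: near_neq0.
apply/derivable1_diffP.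
have di : differentiable (fun u : R[i] => u^-1) z.
  by apply: (differentiableV (differentiable_idC z)).
exact: (differentiable_comp di fd).
Unshelve. all: by end_near. Qed.

Lemma outside_disc_sphere_inv (nu : R) (z : R[i]) : 0 < nu ->
  normc z <= nu^-1 -> outside_disc nu (sphere_inv z).
Proof.
move=> nu0 zn; rewrite /outside_disc /sphere_inv /=; case: ifPn => // z0.
rewrite lecR -/(normc _) Normc.normcV -[leLHS]invrK lef_pV2 ?posrE ?invr_gt0//.
by rewrite normc_gt0.
Qed.

Lemma sphere_inv_nat (n : nat) : (0 < n)%N -> sphere_inv (n%:R^-1 : R[i]) = Some n%:R.
Proof. by move=> n0; rewrite /sphere_inv invr_eq0 pnatr_eq0 gtn_eqF// invrK. Qed.

Lemma Hnorm_partial_sums p d r (w : nat -> 'rV[R[i]]_d -> R[i]) W x :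
  (0 < p)%N -> (forall n, Hspace p r (w n)) -> Edom p r x ->
  (\sum_(0 <= n <oo) (Hnorm p r (w n))%:E <= W%:E)%E ->
  forall n, \sum_(0 <= k < n) normc (w k x) <= W.
Proof.
move=> p0 wH Ex sW n.
have wx k : normc (w k x) <= Hnorm p r (w k) by exact: le_Hnorm.
rewrite -lee_fin; apply: le_trans sW.
apply: (@le_trans _ _ (\sum_(0 <= k < n) (Hnorm p r (w k))%:E)%E).
  by rewrite sumEFin lee_fin; apply: ler_sum => k _.
apply: nneseries_lim_ge => k _ _.
by rewrite lee_fin (le_trans _ (wx k))// normc_ge0.
Qed.

End Sphere.

Unset Implicit Arguments.
Theorem theorem5p9 (R : realType) (p d : nat) (hp : (0 < p)%N) (hd : (0 < d)%N)
  (r rho : R) (hr : 0 < r) (hrho : r < rho)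
  (w : nat -> 'rV[R[i]]_d -> R[i]) (v : nat -> 'rV[R[i]]_d -> 'rV[R[i]]_d)
  (W : R)
  (w_H : forall n, Hspace p rho (w n))
  (v_holo : forall n, holomorphic_on (Edom p rho) (v n))
  (v_maps : forall n z, Edom p rho z -> Edom p r (v n z))
  (w_sum : (\sum_(0 <= n <oo) (Hnorm p rho (w n))%:E <= W%:E)%E)
  (L_maps : forall phi, Hspace p r phi ->
     exists2 psi, Hspace p rho psi &
       forall z, Edom p rho z -> psi z = transfer w v phi z)
  (alpha nu : R) (hnu : 0 < nu)
  (w_ext : forall x, cube x -> exists2 f : sphere R -> R[i],
     sphere_analytic_on (outside_disc nu) f &
     forall k : nat, nu <= k%:R ->
       f (Some k%:R) = (k%:R `^ alpha)%:C * w k x)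
  (V : sphere R -> 'rV[R[i]]_d -> 'rV[R[i]]_d)
  (V_ext : forall x, cube x -> forall k : nat, V (Some k%:R) x = v k x)
  (V_analytic : forall x, cube x ->
     sphere_analytic_on (outside_disc nu) (fun s => V s x))
  (V_maps : forall x s, cube x -> outside_disc nu s -> Edom p r (V s x)) :
  exists Q : R -> nat,
    ((fun e : R => (Q e)%:R : R) =O_ (0^'+) (fun e : R => ln e^-1)) /\
    forall Err : R, 0 < Err ->
      exists (nq : 'I_(Q Err) -> R[i])
             (wq : 'I_(Q Err) -> 'rV[R[i]]_d -> R[i]),
        (forall q, valid_index nu (nq q)) /\
        forall phi, Hspace p r phi -> forall x, cube x ->
          `|transfer w v phi x - \sum_(q < Q Err) wq q x * phi (V (Some (nq q)) x)|
            <= (Hnorm p r phi * Err)%:C.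
Proof.
(* g z = phi (V (1 / z) x) is holomorphic for |z| <= 1 / nu, so the points
   1 / n must satisfy |1 / n| <= 1 / (4 nu). *)
pose N := (Num.truncn (4 * nu)).+1.
have rhoN : 4 <= nu^-1 * N%:R.
  by rewrite mulrC ler_pdivlMr// ltW// truncnS_gt.
(* Summing the interpolation error against w n x multiplies it by at most W. *)
pose D : R := 8 / 3 * (`|W| + 1).
have D0 : 0 < D by rewrite mulr_gt0 ?divr_gt0// ltr_wpDl.
exists (fun e => (N + node_count D e)%N); split; first exact: node_count_bigO.
move=> Err Err0; set M := node_count D Err.
exists (fun q => (nat_of_ord q)%:R).
exists (fun q x => limn (series (fun n => w n x * index_weight n q))).
split; first by move=> q; left; exists q.
move=> phi phiH x xc; rewrite normc_lecR.
have phi_le z : Edom p r z -> normc (phi z) <= Hnorm p r phi by exact: le_Hnorm.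
have Ex : Edom p rho x by apply: cube_sub_Edom => //; exact: lt_trans hrho.
have phiv n : normc (phi (v n x)) <= Hnorm p r phi by exact/phi_le/v_maps.
have B0 : 0 <= Hnorm p r phi := le_trans (normc_ge0 _) (phiv 0%N).
have wW := Hnorm_partial_sums hp w_H Ex w_sum.
have /choice[K KP] (q : 'I_(N + M)) :
    exists K : R, forall n, normc (index_weight n q) <= K.
  exact: index_weight_bounded.
have inside z : normc z <= nu^-1 -> Edom p r (V (sphere_inv z) x).
  by move=> zn; apply: V_maps => //; exact: outside_disc_sphere_inv.
have err n : normc (phi (v n x) - \sum_(q < N + M) index_weight n q * phi (v q x)) <=
    8 / 3 * Hnorm p r phi * (2 / 3) ^+ M.
  apply: (@index_weight_error _ (fun z => phi (V (sphere_inv z) x))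
    (fun k => phi (v k x)) nu^-1) => //.
  - by rewrite invr_gt0.
  - move=> z zn.
    have dV : differentiable ((fun s => V s x) \o @sphere_inv R) z.
      by apply/differentiable_sphere_chart/V_analytic => //;
        exact: outside_disc_sphere_inv.
    by case: phiH => /(_ _ (inside z zn)) dphi _ _;
      exact: (differentiable_comp dV dphi).
  - by move=> z zn; apply/phi_le/inside; rewrite zn.
  - by move=> k Nk; rewrite sphere_inv_nat ?V_ext//; exact: leq_trans Nk.
under eq_bigr do rewrite V_ext//.
apply: le_trans (weighted_interpolation_error wW (fun n q => KP q n) phiv err) _.
have dec := node_countP D0 Err0; rewrite -/M in dec.
have q0 : 0 <= (2 / 3 : R) ^+ M by rewrite exprn_ge0// divr_ge0.
move: (_ ^+ M) q0 dec => q q0 dec.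
have -> : W * (8 / 3 * Hnorm p r phi * q) = Hnorm p r phi * (8 / 3 * W * q) by ring.
apply: ler_wpM2l => //; apply: le_trans dec.
rewrite ler_wpM2r// ler_wpM2l ?divr_ge0//.
by rewrite (le_trans (ler_norm _))// lerDl.
Qed.
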